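(* Let $u$ be the solution of $-\nabla\cdot(\alpha(\mathbf x)\nabla u)=f$ in $\Omega$, $u=0$ on $\partial\Omega$, let $u_h\in U_h$ be its finite element solution, i.e. $a(u_h,v_h)=(f,v_h)$ for all $v_h\in U_h$, and let $$\tilde u_h=u_h+\sum_{\tau\in\mathcal T_h}\gamma_\tau b_\tau,\qquad \gamma_\tau=\left(\int_{\partial\tau}\alpha(\mathbf x)\frac{\partial b_\tau}{\partial\mathbf n}\,ds\right)^{-1}\left(-\int_\tau f\,d\mathbf x-\int_{\partial\tau}\alpha(\mathbf x)\frac{\partial u_h}{\partial\mathbf n}\,ds\right),\quad \tau\in\mathcal T_h,$$ where $b_\tau$ is the bubble function on $\tau$. Then $\tilde u_h$ is elementwise flux-conserving: for all $\tau\in\mathcal T_h$, $$\int_{\partial\tau}\alpha(\mathbf x)\frac{\partial(u-\tilde u_h)}{\partial\mathbf n}\,ds=-\int_\tau f\,d\mathbf x-\int_{\partial\tau}\alpha(\mathbf x)\frac{\partial\tilde u_h}{\partial\mathbf n}\,ds=0.$$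
   Context: $\Omega\subset\mathbb R^d$, $d\ge 2$, is a bounded polygonal (polyhedral) domain. The coefficient $\alpha$ is a bounded, piecewise continuous function on $\Omega$ for which there is a constant $\alpha_0>0$ with $\alpha(\mathbf x)\ge\alpha_0$ for almost all $\mathbf x\in\Omega$. The right-hand side is $f\in L^2(\Omega)$. $\mathcal T_h$ is a quasi-uniform and shape-regular simplicial triangulation of $\Omega$ whose simplices $\tau$ satisfy $\operatorname{diam}(\tau)\le h<1$. For a fixed integer $k\ge1$, the finite element space is $$U_h=\{v\in C(\overline\Omega): v|_\tau\in\mathcal P_k\ \text{for all }\tau\in\mathcal T_h,\ v|_{\partial\Omega}=0\},$$ where $\mathcal P_k$ is the space of polynomials of total degree at most $k$. The forms are $$a(v,w)=\int_\Omega\alpha(\mathbf x)\nabla v\cdot\nabla w\,d\mathbf x,\qquad (v,w)=\int_\Omega vw\,d\mathbf x.$$ For a simplex $\tau\in\mathcal T_h$ with barycentric coordinates $\lambda_1,\dots,\lambda_{d+1}$ (the affine functions with $\lambda_i(\mathbf x_j)=\delta_{ij}$ at the vertices $\mathbf x_j$ of $\tau$), the bubble function is $b_\tau=(d+1)^{d+1}\lambda_1\cdots\lambda_{d+1}$ on $\tau$, extended by zero to the rest of $\Omega$. On $\partial\tau$, $\mathbf n$ is the outward unit normal to $\tau$, and normal derivatives of $u_h$, $b_\tau$ and $\tilde u_h$ are taken from inside $\tau$. The flux $\int_{\partial\tau}\alpha\,\partial u/\partial\mathbf n\,ds$ of the exact solution is that of the vector field $\alpha\nabla u$ (normal trace),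 for which the divergence theorem on $\tau$ is valid. *)

(* Defs.v *)
From HB Require Import structures.
From mathcomp Require Import all_boot all_order all_algebra.
From mathcomp Require Import all_classical all_reals all_analysis.
Set Implicit Arguments. Unset Strict Implicit. Unset Printing Implicit Defensive.
Import Order.TTheory GRing.Theory Num.Theory numFieldNormedType.Exports.
Local Open Scope classical_set_scope. Local Open Scope ring_scope.

Section rV_measurable.
Context {R : realType} {n : nat}.

(* The product sigma-algebra on 'rV_n, i.e. its Borel sets. *)
Definition rV_coord (i : 'I_n) (x : 'rV[R]_n) : measurableTypeR R := x 0 i.

Let rV_set0 : g_sigma_preimage rV_coord set0.
Proof. exact: sigma_algebra0. Qed.
Let rV_setC A : g_sigma_preimage rV_coord A -> g_sigma_preimage rV_coord (~` A).
Proof. exact: sigma_algebraC. Qed.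
Let rV_bigcup (F : (set 'rV[R]_n)^nat) : (forall i, g_sigma_preimage rV_coord (F i)) ->
  g_sigma_preimage rV_coord (\bigcup_i (F i)).
Proof. exact: sigma_algebra_bigcup. Qed.

HB.instance Definition _ := @isMeasurable.Build default_measure_display
  'rV[R]_n (g_sigma_preimage rV_coord) rV_set0 rV_setC rV_bigcup.

Lemma measurable_rV_coord i : measurable_fun setT (rV_coord i).
Proof.
move=> _ Y mY; rewrite setTI; apply: sub_sigma_algebra => /=.
rewrite -bigcup_seq/=; exists i => /=; first by rewrite mem_index_enum.
by exists Y => //; rewrite setTI.
Qed.

Lemma measurable_fun_rVP d (T : measurableType d) (f : T -> 'rV[R]_n) :
  (forall i, measurable_fun setT (fun x => rV_coord i (f x))) -> measurable_fun setT f.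
Proof.
move=> mf _ A mA; rewrite setTI.
suff: g_sigma_preimage rV_coord `<=` [set B | measurable (f @^-1` B)] by apply.
apply: smallest_sub.
  split => /=.
  - by rewrite preimage_set0.
  - by move=> B mB; rewrite setTD preimage_setC; exact: measurableC.
  - by move=> F mF; rewrite preimage_bigcup; exact: bigcup_measurable.
rewrite -bigcup_seq => B [i _ [Y mY <-]] /=.
by rewrite setTI; have := mf i measurableT _ mY; rewrite setTI.
Qed.
End rV_measurable.

Section rV_lebesgue.
Context {R : realType}.

Definition rV_cons n (p : measurableTypeR R * 'rV[R]_n) : 'rV[R]_n.+1 :=
  row_mx (const_mx p.1 : 'rV_1) p.2.

Lemma rV_cons0 n p : @rV_cons n p 0 ord0 = p.1.
Proof.
rewrite /rV_cons; have -> : ord0 = lshift n (ord0 : 'I_1) by exact/val_inj.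
by rewrite (row_mxEl (const_mx p.1 : 'rV[R]_1)) mxE.
Qed.

Lemma rV_consS n p i : @rV_cons n p 0 (lift ord0 i) = p.2 0 i.
Proof.
rewrite /rV_cons; have -> : lift ord0 i = rshift 1 i by exact/val_inj.
by rewrite (row_mxEr (const_mx p.1 : 'rV[R]_1)).
Qed.

Lemma measurable_rV_cons n : measurable_fun setT (@rV_cons n).
Proof.
apply: measurable_fun_rVP => i; rewrite /rV_coord; case: (unliftP ord0 i) => [j|] ->.
  under eq_fun do rewrite rV_consS.
  exact: (measurableT_comp (measurable_rV_coord j) measurable_snd).
under eq_fun do rewrite rV_cons0.
exact: measurable_fst.
Qed.

Definition rV_uncons n (x : 'rV[R]_n.+1) : measurableTypeR R * 'rV[R]_n :=
  (x 0 ord0, \row_i x 0 (lift ord0 i)).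

Lemma rV_consK n : cancel (@rV_cons n) (@rV_uncons n).
Proof.
move=> [a y]; rewrite /rV_uncons rV_cons0; congr pair.
by apply/rowP => i; rewrite mxE rV_consS.
Qed.
Lemma rV_unconsK n : cancel (@rV_uncons n) (@rV_cons n).
Proof.
move=> x; apply/rowP => i; case: (unliftP ord0 i) => [j|] ->.
  by rewrite rV_consS mxE.
by rewrite rV_cons0.
Qed.

Lemma measurable_rV_uncons n : measurable_fun setT (@rV_uncons n).
Proof.
rewrite /rV_uncons; apply: measurable_fun_pair; first exact: measurable_rV_coord.
apply: measurable_fun_rVP => i; rewrite /rV_coord.
under eq_fun do rewrite mxE.
exact: measurable_rV_coord.
Qed.

Section step.
Variables (n : nat) (mu : {sigma_finite_measure set 'rV[R]_n -> \bar R}).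

Definition rV_lebesgueS : set 'rV[R]_n.+1 -> \bar R :=
  pushforward (lebesgue_measure \x mu)%E (@rV_cons n).

Let m0 : rV_lebesgueS set0 = 0%E.
Proof. by rewrite /rV_lebesgueS /pushforward preimage_set0 measure0. Qed.
Let m_ge0 A : (0 <= rV_lebesgueS A)%E.
Proof. by rewrite /rV_lebesgueS /pushforward; exact: measure_ge0. Qed.
Let m_sa : semi_sigma_additive rV_lebesgueS.
Proof.
move=> F mF tF mUF; rewrite /rV_lebesgueS /pushforward preimage_bigcup.
apply: measure_semi_sigma_additive.
- by move=> k; rewrite -[X in measurable X]setTI; exact: measurable_rV_cons.
- apply/trivIsetP => /= i j _ _ ij; rewrite -preimage_setI.
  by move/trivIsetP : tF => /(_ _ _ _ _ ij) ->//; rewrite preimage_set0.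
- by rewrite -preimage_bigcup -[X in measurable X]setTI; exact: measurable_rV_cons.
Qed.
HB.instance Definition _ := isMeasure.Build _ _ _ rV_lebesgueS m0 m_ge0 m_sa.

Let m_sf : sigma_finite setT rV_lebesgueS.
Proof.
have /sigma_finiteP[F [TF ndF Foo]] := sigma_finiteT (@lebesgue_measure R).
have /sigma_finiteP[G [TG ndG Goo]] := sigma_finiteT mu.
exists (fun k => @rV_uncons n @^-1` (F k `*` G k)).
  rewrite -preimage_bigcup (_ : \bigcup_k _ = setT) ?preimage_setT//.
  rewrite -subTset => -[x y] _.
  have [k _ Fk] : (\bigcup_k F k) x by rewrite -TF.
  have [l _ Gl] : (\bigcup_k G k) y by rewrite -TG.
  exists (maxn k l) => //; split=> /=.
  - by move: x Fk; exact/subsetPset/ndF/leq_maxl.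
  - by move: y Gl; exact/subsetPset/ndG/leq_maxr.
move=> k; have [mF Fk] := Foo k; have [mG Gk] := Goo k; split.
  rewrite -[X in measurable X]setTI.
  by apply: measurable_rV_uncons => //; exact: measurableX.
rewrite /rV_lebesgueS /pushforward -comp_preimage.
rewrite (_ : _ \o _ = id) ?preimage_id; last first.
  by apply/funext => p /=; rewrite rV_consK.
by rewrite product_measure1E// lte_mul_pinfty// ge0_fin_numE.
Qed.
HB.instance Definition _ :=
  Measure_isSigmaFinite.Build _ _ _ rV_lebesgueS m_sf.
End step.

(* n-dimensional Lebesgue measure as an iterated product; it is identified by
   rV_lebesgue_box below. *)
Fixpoint rV_lebesgue n : {sigma_finite_measure set 'rV[R]_n -> \bar R} :=
  if n is m.+1 then rV_lebesgueS (rV_lebesgue m) else dirac (0 : 'rV[R]_0).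

Lemma rV_lebesgue_box n (A : 'I_n -> set R) :
  (forall i, measurable (A i)) ->
  rV_lebesgue n [set x | forall i, A i (x 0 i)] =
  (\prod_(i < n) lebesgue_measure (A i))%E.
Proof.
elim: n A => [|n IH] A mA.
  by rewrite big_ord0 /= diracE mem_set//= => -[].
have mB : measurable [set y : 'rV[R]_n | forall i, A (lift ord0 i) (y 0 i)].
  have -> : [set y : 'rV[R]_n | forall i, A (lift ord0 i) (y 0 i)] =
      \bigcap_(i in setT) (rV_coord i @^-1` A (lift ord0 i)).
    by apply/seteqP; split => x /= h i => [_|]; exact: h.
  apply: fin_bigcap_measurable => // i _.
  have := @measurable_rV_coord R n i measurableT _ (mA (lift ord0 i)).
  by rewrite setTI.
rewrite big_ord_recl -(IH (fun i => A (lift ord0 i)))// -product_measure1E//.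
rewrite [LHS]/= /rV_lebesgueS /pushforward; congr (_ _).
apply/seteqP; split => [p /= h|p [/= h0 h] i].
  by split=> [|i]; [rewrite -(rV_cons0 p)|rewrite -(rV_consS p)]; exact: h.
by case: (unliftP ord0 i) => [j|] ->; rewrite ?rV_consS ?rV_cons0.
exact: (mA ord0).
Qed.
End rV_lebesgue.

Notation leb n := (rV_lebesgue n).

Section euclidean.
Context {R : realType} {d : nat}.
Local Notation E := 'rV[R]_d.

(* The norm `|x| of the library on 'rV_d is the sup norm, hence these. *)
Definition dot (x y : E) : R := \sum_i x 0 i * y 0 i.
Definition enorm (x : E) : R := Num.sqrt (dot x x).
Definition diam (A : set E) : R :=
  sup [set enorm (p.1 - p.2) | p in A `*` A].

Definition grad (f : E -> R) (x : E) : E := \row_i 'D_(delta_mx 0 i) f x.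

Definition C1 (f : E -> R) : Prop := forall i : 'I_d,
  (forall x, derivable f x (delta_mx 0 i)) /\
  continuous (fun x : E => 'D_(delta_mx 0 i) f x : R).

Definition bnd (U : set E) : set E := closure U `\` interior U.

(* Polynomials of total degree at most k, in the monomial basis. *)
Definition is_poly (k : nat) (p : E -> R) : Prop :=
  exists c : {ffun 'I_d -> 'I_k.+1} -> R, forall x,
    p x = \sum_(m : {ffun 'I_d -> 'I_k.+1} | (\sum_i m i <= k)%N)
            c m * \prod_i x 0 i ^+ m i.

End euclidean.

Section sobolev.
Context {R : realType} {d : nat}.
Local Notation E := 'rV[R]_d.
Implicit Types (U : set E) (u v f g : E -> R) (sigma : E -> E).

Definition L2 U f : Prop := (f \_ U) \in Lfun (leb d) 2%:E.

(* C^1_c(U). First-order weak derivatives may be tested with it equivalently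
   to C^oo_c(U). *)
Definition test_fun U (phi : E -> R) : Prop :=
  [/\ C1 phi, compact (closure [set x | phi x != 0]) &
      closure [set x | phi x != 0] `<=` U].

Definition is_weak_grad U u (G : E -> E) : Prop :=
  (forall i, L2 U (fun x => G x 0 i)) /\
  forall phi, test_fun U phi -> forall i,
    \int[leb d]_(x in U) (u x * grad phi x 0 i) =
    - \int[leb d]_(x in U) (G x 0 i * phi x).

Definition weak_grad U u : E -> E := xget (cst 0) [set G | is_weak_grad U u G].

Definition is_weak_div U sigma g : Prop :=
  L2 U g /\
  forall phi, test_fun U phi ->
    \int[leb d]_(x in U) dot (sigma x) (grad phi x) =
    - \int[leb d]_(x in U) (g x * phi x).

Definition weak_div U sigma : E -> R :=
  xget (cst 0) [set g | is_weak_div U sigma g].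

(* The pairing <sigma . n, phi> over the boundary of U of the normal trace of a
   field sigma of H(div, U) with phi, given by Green's formula. *)
Definition normal_trace U sigma (phi : E -> R) : R :=
  \int[leb d]_(x in U)
    (dot (sigma x) (grad phi x) + weak_div U sigma x * phi x).

Definition normal_flux U sigma : R := normal_trace U sigma (cst 1).

Definition H1 U u : Prop := L2 U u /\ exists G, is_weak_grad U u G.

(* The closure of C^1_c(U) in H^1(U). *)
Definition H10 U u : Prop :=
  H1 U u /\
  exists phi : nat -> E -> R,
    [/\ forall m, test_fun U (phi m),
        (fun m => \int[leb d]_(x in U) (u x - phi m x) ^+ 2) @ \oo --> (0 : R) &
        (fun m => \int[leb d]_(x in U)
           enorm (weak_grad U u x - grad (phi m) x) ^+ 2) @ \oo --> (0 : R)].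

Definition energy_form U (alpha : E -> R) v w : R :=
  \int[leb d]_(x in U) (alpha x * dot (weak_grad U v x) (weak_grad U w x)).

Definition L2_form U v w : R := \int[leb d]_(x in U) (v x * w x).

(* -div (alpha grad u) = f in U, u = 0 on the boundary of U. *)
Definition is_solution U (alpha f u : E -> R) : Prop :=
  H10 U u /\
  is_weak_div U (fun x => alpha x *: weak_grad U u x) (fun x => - f x).

(* U is, up to finitely many C^1 hypersurfaces, a finite disjoint union of open
   pieces, on each of which alpha is continuous up to the boundary. The values
   of alpha on the hypersurfaces are arbitrary. *)
Definition piecewise_continuous U (alpha : E -> R) : Prop :=
  exists (p s : nat) (P : 'I_p -> set E) (psi : 'I_s -> E -> R),
    [/\ forall j, open (P j) /\ P j `<=` U,
        forall i j, i != j -> P i `&` P j = set0,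
        forall l, C1 (psi l) /\ forall x, psi l x = 0 -> grad (psi l) x != 0,
        U `\` \bigcup_j P j `<=` \bigcup_l [set x | psi l x = 0] &
        forall j, exists beta : E -> R,
          {within closure (P j), continuous beta} /\
          {in P j, alpha =1 beta}].

End sobolev.

Section simplices.
Context {R : realType} {d : nat}.
Local Notation E := 'rV[R]_d.

(* Points x_0, .., x_(m-1) of R^d are given as the rows of a matrix. *)
Definition aff_indep m (V : 'M[R]_(m, d)) : bool :=
  row_free (row_mx (const_mx 1 : 'M[R]_(m, 1)) V).

Definition hull m (V : 'M[R]_(m, d)) (P : pred 'I_m) : set E :=
  [set w *m V | w in [set w : 'rV[R]_m |
    [/\ forall i, 0 <= w 0 i, forall i, ~~ P i -> w 0 i = 0 &
        \sum_i w 0 i = 1]]].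

Definition simplex m (V : 'M[R]_(m, d)) : set E := hull V predT.

Definition polyhedral_domain (Omega : set E) : Prop :=
  [/\ Omega !=set0, open Omega, connected Omega, bounded_set Omega &
      exists (N : nat) (F : 'I_N -> 'M[R]_(d, d)),
        (forall k, aff_indep (F k)) /\
        bnd Omega = \bigcup_k simplex (F k)].

Definition triangulation (Omega : set E) N (T : 'I_N -> 'M[R]_(d.+1, d)) : Prop :=
  [/\ forall i, aff_indep (T i),
      closure Omega = \bigcup_i simplex (T i),
      forall i, interior (simplex (T i)) `<=` Omega,
      forall i j, i != j ->
        interior (simplex (T i)) `&` interior (simplex (T j)) = set0 &
      forall i j, simplex (T i) `&` simplex (T j) =
        hull (T i) [pred a | [exists b, row a (T i) == row b (T j)]]].

Definition shape_regular (kappa : R) N (T : 'I_N -> 'M[R]_(d.+1, d)) : Prop :=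
  forall i, exists (c : E) (r : R),
    [/\ 0 < r, [set x | enorm (x - c) <= r] `<=` simplex (T i) &
        diam (simplex (T i)) <= kappa * r].

Definition quasi_uniform (kappa : R) N (T : 'I_N -> 'M[R]_(d.+1, d)) : Prop :=
  forall i j, diam (simplex (T i)) <= kappa * diam (simplex (T j)).

Definition fe_space (Omega : set E) (k : nat) N (T : 'I_N -> 'M[R]_(d.+1, d)) :
    set (E -> R) :=
  [set v | [/\ {within closure Omega, continuous v},
      forall i, exists p, is_poly k p /\ {in simplex (T i), v =1 p} &
      forall x, bnd Omega x -> v x = 0]].

Definition is_fe_solution (Omega : set E) (k : nat) N
    (T : 'I_N -> 'M[R]_(d.+1, d)) (alpha f uh : E -> R) : Prop :=
  fe_space Omega k T uh /\
  forall vh, fe_space Omega k T vh ->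
    energy_form Omega alpha uh vh = L2_form Omega f vh.

(* The solution lambda of sum_i lambda_i = 1, sum_i lambda_i x_i = x. *)
Definition bary (V : 'M[R]_(d.+1, d)) (x : E) : 'rV[R]_d.+1 :=
  row_mx (const_mx 1 : 'M[R]_(1, 1)) x *m
  invmx (row_mx (const_mx 1 : 'M[R]_(d.+1, 1)) V : 'M[R]_d.+1).

Definition bubble (V : 'M[R]_(d.+1, d)) : E -> R :=
  (fun x => d.+1%:R ^+ d.+1 * \prod_i bary V x 0 i) \_ (simplex V).

(* Values and normal derivatives at y from the side of -nu. *)
Definition inner_trace (nu : E) (alpha : E -> R) (y : E) : R :=
  lim (alpha (y - t *: nu) @[t --> (0 : R)^'+]).

Definition inner_nderiv (nu : E) (v : E -> R) (y : E) : R :=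
  lim ((v y - v (y - t *: nu)) / t @[t --> (0 : R)^'+]).

End simplices.

Section fluxes.
(* Here the space dimension d is n.+1. *)
Context {R : realType} {n : nat}.
Local Notation E := 'rV[R]_n.+1.

Definition edges (F : 'M[R]_(n.+1, n.+1)) : 'M[R]_(n, n.+1) :=
  \matrix_(j < n) (row (lift ord0 j) F - row ord0 F).

(* Integral of g over the (d-1)-simplex with vertices the rows of F, through its
   affine parametrization by the unit simplex of R^(d-1), with the Gram
   determinant as surface element. *)
Definition surface_int (F : 'M[R]_(n.+1, n.+1)) (g : E -> R) : R :=
  Num.sqrt (\det (edges F *m (edges F)^T)) *
  \int[leb n]_(t in [set t : 'rV[R]_n |
      (forall j, 0 <= t 0 j) /\ \sum_j t 0 j <= 1])
    g (row ord0 F + t *m edges F).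

(* The face of a d-simplex opposite to its vertex i is row' i V. *)
Definition outward_normal (V : 'M[R]_(n.+2, n.+1)) (i : 'I_n.+2) : E :=
  xget 0 [set nu | [/\ enorm nu = 1,
    forall a b, a != i -> b != i -> dot nu (row a V - row b V) = 0 &
    forall a, a != i -> 0 < dot nu (row a V - row i V)]].

(* The integral of alpha dv/dn over the boundary of the simplex, alpha and v
   being taken from inside. *)
Definition bnd_flux (alpha : E -> R) (V : 'M[R]_(n.+2, n.+1)) (v : E -> R) : R :=
  \sum_(i < n.+2) surface_int (row' i V) (fun y =>
    inner_trace (outward_normal V i) alpha y *
    inner_nderiv (outward_normal V i) v y).

Definition bubble_coef (alpha f uh : E -> R) (V : 'M[R]_(n.+2, n.+1)) : R :=
  (bnd_flux alpha V (bubble V))^-1 *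
  (- (\int[leb n.+1]_(x in simplex V) f x) - bnd_flux alpha V uh).

Definition corrected (alpha f uh : E -> R) N (T : 'I_N -> 'M[R]_(n.+2, n.+1)) :
    E -> R :=
  fun x => uh x + \sum_(i < N) bubble_coef alpha f uh (T i) * bubble (T i) x.

(* The integral of alpha d(u - v)/dn over the boundary of the simplex, for u
   with alpha grad u in H(div) and v piecewise polynomial. *)
Definition bnd_flux_sub (Omega : set E) (alpha : E -> R)
    (V : 'M[R]_(n.+2, n.+1)) (u v : E -> R) : R :=
  normal_flux (interior (simplex V)) (fun x => alpha x *: weak_grad Omega u x)
  - bnd_flux alpha V v.

End fluxes.

(* Main.v *)
(* The flux of the exact solution through the boundary of a simplex is minus the
   integral of [f]: testing the weak divergence with C^1 cutoffs that increase to
   the indicator of the open simplex determines its integral. The flux of the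
   corrected function is affine in the bubble coefficient, so everything rests on
   two facts. First, for almost every point of a face the inner trace of [alpha]
   exists and lies in [[alpha0, M]], because the inward normal ray avoids all
   discontinuity hypersurfaces [psi = 0] near the face unless [psi] and its normal
   derivative vanish at the point; as [grad psi != 0], the point is then a regular
   zero of the restriction of [psi] to the face, and regular zeros form a null set
   because they are isolated on coordinate lines. Second, the bubble vanishes on
   the faces and its normal derivative is negative on their relative interiors, so
   its flux is negative. *)
Require Import Defs.
From HB Require Import structures.
From mathcomp Require Import all_boot all_order all_algebra.
From mathcomp Require Import all_classical all_reals all_analysis.
From mathcomp Require Import measurable_realfun ring lra.
Set Implicit Arguments. Unset Strict Implicit. Unset Printing Implicit Defensive.
Import Order.TTheory GRing.Theory Num.Theory numFieldNormedType.Exports.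
Local Open Scope classical_set_scope.
Local Open Scope ring_scope.

(** * Borel and null sets of R^n *)

(** [inner_trace] and [inner_nderiv] are values of [lim], which mean nothing where the limit fails
    to exist, so the surface integrands are uncontrolled, possibly not even measurable, on a null
    set of parameters. Linearity of the flux and the strict sign of the bubble flux are therefore
    obtained only after each face integral has been moved to a measurable set of parameters, of full
    measure in the reference simplex, on which the trace exists, is measurable and is bounded. The
    lower bound on the trace has to come from inside: [alpha >= alpha0] is known almost everywhere
    in [Omega], which says nothing about a face or about a single ray. Continuity on the open pieces
    turns it into a bound at every point of a piece, and this one passes to the limit along a ray.
    On the side of the exact solution, the weak divergence is an arbitrary representative picked by
    [xget], so it is compared with [- f] through integrals over the simplex. *)

Section rV_borel.
Context {R : realType}.

(** The sigma-algebra is generated by the coordinates, so boxes are measurable. The open cubes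
    [B qk] with rational centre and half-side 1/(k+1) are countably many, and those contained in [U]
    cover it. *)
Lemma open_measurable_rV n (U : set 'rV[R]_n) : open U -> measurable U.
Proof.
move=> oU.
pose B (qk : 'rV[rat]_n * nat) : set 'rV[R]_n :=
  [set y | forall i, y 0 i \in `](ratr (qk.1 0 i) - qk.2.+1%:R^-1),
                               (ratr (qk.1 0 i) + qk.2.+1%:R^-1)[].
have mB qk : measurable (B qk).
  have -> : B qk = \bigcap_(i in setT) (rV_coord i @^-1`
     [set` `](ratr (qk.1 0 i) - qk.2.+1%:R^-1), (ratr (qk.1 0 i) + qk.2.+1%:R^-1)[]).
    by apply/seteqP; split => x /= h i => [_|]; exact: h.
  apply: fin_bigcap_measurable => // i _.
  have := @measurable_rV_coord R n i measurableT _ (measurable_itv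
    `](ratr (qk.1 0 i) - qk.2.+1%:R^-1), (ratr (qk.1 0 i) + qk.2.+1%:R^-1)[).
  by rewrite setTI.
rewrite (_ : U = \bigcup_(qk : 'rV[rat]_n * nat)
    (if `[< B qk `<=` U >] then B qk else set0)); last first.
  apply/seteqP; split => [x Ux|x [qk _]]; last first.
    by case: asboolP => // h; exact: h.
  have /nbhs_ballP[e /= e0 he] : nbhs x U by apply: open_nbhs_nbhs.
  (* The centre of the cube is chosen within [r] of [x] and the half-side is [r], so [r < e / 2]
     keeps the cube in the ball. *)
  have [k hk] : exists k : nat, k.+1%:R^-1 < e / 2.
    have [k hk] := ltr_add_invr (divr_gt0 e0 (ltr0n _ 2)).
    by exists k; move: hk; rewrite add0r.
  have k0 : 0 < k.+1%:R^-1 :> R by rewrite invr_gt0.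
  have [r [r0 re rE]] : exists r : R, [/\ 0 < r, r < e / 2 & r = k.+1%:R^-1] by exists k.+1%:R^-1.
  have hq i : exists q : rat, ratr q \in `](x 0 i - r), (x 0 i + r)[.
    by have := @rat_in_itvoo R (x 0 i - r) (x 0 i + r); apply; lra.
  have [q hqq] := choice hq.
  exists (\row_i q i, k) => //.
  case: asboolP => [_ i|[]]; rewrite ?/B /= -rE.
    by rewrite mxE; have := hqq i; rewrite !in_itv /= => /andP[h1 h2]; apply/andP; split; lra.
  move=> y /= By; apply: he; split => // i j; rewrite ord1 /ball /=.
  have := By j; have := hqq j; rewrite mxE !in_itv /= => /andP[h1 h2] /andP[h3 h4].
  rewrite ltr_norml; apply/andP; split; lra.
apply: countable_bigcupT_measurable; first exact: countableP.
by move=> qk; case: ifP.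
Qed.

Lemma closed_measurable_rV n (U : set 'rV[R]_n) : closed U -> measurable U.
Proof.
by move=> cU; rewrite -[U]setCK; apply: measurableC; apply: open_measurable_rV; exact: closed_openC.
Qed.

Lemma continuous_on_open_measurable n (W : set 'rV[R]_n) (f : 'rV[R]_n -> R) :
  open W -> (forall x, W x -> {for x, continuous f}) -> measurable_fun W f.
Proof.
move=> oW cf; apply: (measurability _ (RGenOpens.measurableE R)).
move=> _ [_ [a [b ->]] <-].
apply: open_measurable_rV; rewrite openE => x [Wx fx].
apply: filterI; first exact: open_nbhs_nbhs.
apply: cf => //; apply: open_nbhs_nbhs; split => //.
Qed.

Lemma continuous_measurable_rV n (f : 'rV[R]_n -> R) : continuous f -> measurable_fun setT f.
Proof. by move=> cf; apply: (continuous_on_open_measurable openT) => x _; exact: cf. Qed.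

Lemma continuous_measurable_rV_rV n m (f : 'rV[R]_n -> 'rV[R]_m) :
  continuous f -> measurable_fun setT f.
Proof.
move=> cf; apply: measurable_fun_rVP => i; apply: continuous_measurable_rV => x.
apply: (@continuous_comp _ _ _ f (fun y => y 0 i)); first exact: cf.
exact: coord_continuous.
Qed.

Lemma rV_cons_add_lift n (j : 'I_n) a y (s : R) :
  rV_cons (a, y + s *: delta_mx 0 j) = rV_cons (a, y) + s *: delta_mx 0 (lift ord0 j).
Proof.
apply/rowP => k; rewrite [RHS]mxE [X in _ = _ + X]mxE [X in _ = _ + _ * X]mxE /=.
case: (unliftP ord0 k) => [l|] ->; last by rewrite !rV_cons0 mulr0 addr0.
by rewrite !rV_consS /= !mxE (inj_eq lift_inj).
Qed.

Lemma rV_cons_add0 n a (y : 'rV[R]_n) :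
  rV_cons (a, y) = rV_cons (0, y) + a *: delta_mx 0 ord0.
Proof.
apply/rowP => k; rewrite [RHS]mxE [X in _ = _ + X]mxE [X in _ = _ + _ * X]mxE /=.
case: (unliftP ord0 k) => [l|] ->; last by rewrite !rV_cons0 eqxx mulr1 add0r.
by rewrite !rV_consS /= mulr0 addr0.
Qed.

(** Fubini on the iterated product. For a direction other than the first, the first coordinate is
    frozen and induction applies to the section. *)
Lemma null_line_slices n (i : 'I_n) (A : set 'rV[R]_n) : measurable A ->
  (forall x, lebesgue_measure [set s : R | A (x + s *: delta_mx 0 i)] = 0%E) ->
  leb n A = 0%E.
Proof.
elim: n i A => [[]//|n IH] i A mA hA.
have mA' : measurable (@rV_cons R n @^-1` A).
  by have := @measurable_rV_cons R n measurableT _ mA; rewrite setTI.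
rewrite /= /rV_lebesgueS /pushforward.
case: (unliftP ord0 i) hA => [j|] -> hA.
  rewrite /product_measure1; apply: integral0_eq => a _ /=.
  apply: (IH j); first exact: measurable_xsection.
  move=> y; rewrite -[RHS](hA (rV_cons (a, y))); congr (lebesgue_measure _).
  by apply/seteqP; split => s /=; rewrite /xsection /= inE /= rV_cons_add_lift.
(* Lines in the first direction are sections at a fixed tail, so the order of integration is
   swapped; the two product measures agree by uniqueness. *)
transitivity ((lebesgue_measure \x^ leb n)%E (@rV_cons R n @^-1` A)).
  apply: product_measure_unique => // B C mB mC.
  exact: product_measure2E.
rewrite /product_measure2; apply: integral0_eq => y _ /=.
rewrite -[RHS](hA (rV_cons (0, y))); congr (lebesgue_measure _).
by apply/seteqP; split => s /=; rewrite /ysection /= inE /= (rV_cons_add0 s).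
Qed.

Lemma null_countable_slices n (i : 'I_n) (A : set 'rV[R]_n) : measurable A ->
  (forall x, countable [set s : R | A (x + s *: delta_mx 0 i)]) -> leb n A = 0%E.
Proof.
by move=> mA cA; apply: (null_line_slices mA) => x; exact: countable_lebesgue_measure0.
Qed.

Lemma rV_norm_leP n (x : 'rV[R]_n) (c : R) : 0 <= c ->
  reflect (forall i, `|x 0 i| <= c) (`|x| <= c).
Proof.
move=> c0; have -> : `|x| = mx_norm x by []. rewrite mx_normrE; apply: (iffP (bigmax_leP _ _ _ _)) => [[_ h] i|h].
  exact: (h (0, i)).
by split => // -[i j] _; rewrite ord1; exact: h.
Qed.

Lemma coord_le_norm n (x : 'rV[R]_n) i : `|x 0 i| <= `|x|.
Proof. exact/rV_norm_leP. Qed.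

Lemma open_rV_lebesgue_gt0 n (U : set 'rV[R]_n) : open U -> U !=set0 ->
  (0 < leb n U)%E.
Proof.
move=> oU [x Ux].
have /nbhs_ballP[e /= e0 he] : nbhs x U by apply: open_nbhs_nbhs.
pose A (i : 'I_n) := [set` `](x 0 i - e), (x 0 i + e)[].
have mA i : measurable (A i) by exact: measurable_itv.
apply: (@lt_le_trans _ _ (leb n [set y : 'rV[R]_n | forall i, A i (y 0 i)])).
  rewrite rV_lebesgue_box //.
  elim/big_ind: _ => [|a b|i _]; [by rewrite lte_fin|exact: mule_gt0|].
  rewrite /A lebesgue_measure_itv /= lte_fin ifT; last by lra.
  by rewrite -EFinB lte_fin; lra.
apply: le_measure; rewrite ?inE; last 2 first.
- exact: open_measurable_rV.
- move=> y hy; apply: he; split => // i j; rewrite ord1 /ball /=.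
  have := hy j; rewrite /A /= in_itv /= => /andP[h1 h2].
  by rewrite ltr_norml; apply/andP; split; lra.
have -> : [set y : 'rV[R]_n | forall i, A i (y 0 i)] = \bigcap_(i in setT) (rV_coord i @^-1` A i).
  by apply/seteqP; split => y /= h i => [_|]; exact: h.
apply: fin_bigcap_measurable => // i _.
by have := @measurable_rV_coord R n i measurableT _ (mA i); rewrite setTI.
Qed.

Lemma bounded_rV_lebesgue_lty n (U : set 'rV[R]_n) (M : R) : measurable U ->
  (forall x, U x -> forall i, `|x 0 i| <= M) -> (leb n U < +oo)%E.
Proof.
move=> mU hU.
pose A (i : 'I_n) := [set` `[(- M), M]].
have mA i : measurable (A i) by exact: measurable_itv.
apply: (@le_lt_trans _ _ (leb n [set y : 'rV[R]_n | forall i, A i (y 0 i)])).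
  apply: le_measure; rewrite ?inE //; last first.
    by move=> y Uy i; rewrite /A /= in_itv /=; have := hU _ Uy i; rewrite ler_norml.
  have -> : [set y : 'rV[R]_n | forall i, A i (y 0 i)] = \bigcap_(i in setT) (rV_coord i @^-1` A i).
    by apply/seteqP; split => y /= h i => [_|]; exact: h.
  apply: fin_bigcap_measurable => // i _.
  by have := @measurable_rV_coord R n i measurableT _ (mA i); rewrite setTI.
rewrite rV_lebesgue_box // -ge0_fin_numE ?prode_ge0 // prode_fin_num // => i _.
by rewrite /A lebesgue_measure_itv /=; case: ifP.
Qed.

End rV_borel.

(** * Null sets and integrals that do not see them *)

Lemma measure_fin_bigsetU0 d (T : measurableType d) (R : realType)
    (mu : {measure set T -> \bar R}) (I : Type) (s : seq I) (F : I -> set T) :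
  (forall i, measurable (F i)) -> (forall i, mu (F i) = 0%E) ->
  mu (\big[setU/set0]_(i <- s) F i) = 0%E.
Proof.
move=> mF F0; elim: s => [|i s IH]; first by rewrite big_nil measure0.
rewrite big_cons setUC measureU0 //; exact: bigsetU_measurable.
Qed.

(* The integrands may be non-measurable on the null set, which rules out
   [ae_eq_integral]. *)
Section integral_modification.
Context d (T : measurableType d) (R : realType) (mu : {measure set T -> \bar R}).
Local Open Scope ereal_scope.
Import HBNNSimple.

(** The integral of a nonnegative function is a supremum over simple functions below it. A simple
    function below [f], set to 0 on [N], keeps its integral and lies below [g]. *)
Lemma ge0_le_integral_off_null (N : set T) (f g : T -> \bar R) :
  measurable N -> mu N = 0 -> (forall x, 0 <= f x) -> (forall x, 0 <= g x) ->
  (forall x, ~ N x -> f x = g x) -> \int[mu]_x f x <= \int[mu]_x g x.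
Proof.
move=> mN N0 f0 g0 fg; rewrite !ge0_integralTE//.
apply: ge_ereal_sup => _ [h /= hf <-].
have mNC : measurable (~` N) by exact: measurableC.
pose h' := proj_nnsfun h mNC.
have -> : sintegral mu h = sintegral mu h'.
  rewrite -!integralT_nnsfun; apply: ge0_ae_eq_integral => //.
  - by apply/measurable_EFinP.
  - by apply/measurable_EFinP.
  - by move=> x _; rewrite lee_fin; exact: fun_ge0.
  - by move=> x _; rewrite lee_fin; exact: fun_ge0.
  exists N; split => // x /=; apply: contra_notP => Nx _.
  by rewrite mindicE mem_set ?mulr1.
apply: ereal_sup_ubound; exists h' => // x /=.
rewrite mindicE; case: (pselect (N x)) => Nx.
  by rewrite memNset ?mulr0.
by rewrite mem_set// mulr1 -fg.
Qed.

Lemma integral_off_null (N D : set T) (f g : T -> \bar R) :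
  measurable N -> mu N = 0 -> (forall x, D x -> ~ N x -> f x = g x) ->
  \int[mu]_(x in D) f x = \int[mu]_(x in D) g x.
Proof.
move=> mN N0 fg.
have key (f1 g1 : T -> \bar R) : (forall x, 0 <= f1 x) -> (forall x, 0 <= g1 x) ->
    (forall x, ~ N x -> f1 x = g1 x) -> \int[mu]_x f1 x = \int[mu]_x g1 x.
  move=> f0 g0 fg1; apply/eqP; rewrite eq_le; apply/andP; split.
    exact: ge0_le_integral_off_null fg1.
  by apply: (ge0_le_integral_off_null mN N0) => // x Nx; rewrite fg1.
rewrite integral_mkcond [RHS]integral_mkcond integralE [RHS]integralE.
have h x : ~ N x -> (f \_ D) x = (g \_ D) x.
  by move=> Nx; rewrite /patch; case: ifPn => // /[!inE] Dx; exact: fg.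
by congr (_ - _); apply: key => // x Nx; rewrite ?funeposE ?funenegE h.
Qed.

Lemma integral_setD_null (D N D' : set T) (f : T -> \bar R) :
  measurable N -> mu N = 0 -> D `\` N `<=` D' -> D' `<=` D ->
  \int[mu]_(x in D) f x = \int[mu]_(x in D') f x.
Proof.
move=> mN N0 DN DD; rewrite integral_mkcond [RHS]integral_mkcond.
apply: (integral_off_null mN N0) => x _ Nx; rewrite /patch.
case: ifPn => [/[!inE] Dx|/negP Dx]; first by rewrite mem_set//; exact: DN.
by rewrite memNset// => D'x; apply: Dx; rewrite inE; exact: DD.
Qed.

End integral_modification.

(** * Functions of class C^1 *)

Lemma cvg_sumr {R : realType} (T : Type) (F : set_system T) {FF : Filter F}
    (I : finType) (g : I -> T -> R) (l : I -> R) :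
  (forall i, g i @ F --> l i) -> (fun x => \sum_i g i x) @ F --> \sum_i l i.
Proof.
move=> h; elim: (index_enum I) => [|i s IH].
  rewrite big_nil; under eq_fun do rewrite big_nil; exact: cvg_cst.
rewrite big_cons; under eq_fun do rewrite big_cons; exact: cvgD.
Qed.

Lemma cvg_continuous_rV {R : realType} n (f : 'rV[R]_n -> R) :
  (forall x : 'rV[R]_n, f @ nbhs x --> f x) -> continuous f.
Proof. by move=> h x; exact: h. Qed.

Section directional.
Context {R : realType} {d : nat}.
Local Notation E := 'rV[R]_d.
Implicit Types (f g : E -> R) (v x y : E).

Lemma is_derive_affine f y v (c : R) :
  (forall h : R, f (y + h *: v) = f y + h * c) -> is_derive y v f c.
Proof.
move=> hf.
have h : (fun h : R => h^-1 *: ((f \o shift y) (h *: v) - f y)) @ 0^' --> c.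
  apply: (@cvg_trans _ (cst c @ 0^')); last exact: cvg_cst.
  apply: near_eq_cvg; near=> h => /=.
  rewrite [_ + y]addrC hf addrAC subrr add0r /GRing.scale /= mulKf //.
  by near: h; exact: nbhs_dnbhs_neq.
by split; [apply/cvg_ex; exists c|exact: cvg_lim h].
Unshelve. all: by end_near. Qed.

Lemma derive_line f v x (s : R) : derivable f (x + s *: v) v ->
  is_derive s (1 : R) (fun s : R => f (x + s *: v)) ('D_v f (x + s *: v)).
Proof.
move=> df.
have eqf : (fun h : R => h^-1 *: (((fun s : R => f (x + s *: v)) \o shift s) (h *: (1 : R)) - f (x + s *: v)))
    = (fun h : R => h^-1 *: ((f \o shift (x + s *: v)) (h *: v) - f (x + s *: v))).
  apply/funext => h /=; congr (_ *: (f _ - _)).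
  by rewrite [h *: 1]mulr1 scalerDl addrCA.
by split; rewrite /derivable /derive eqf.
Qed.

Lemma MVT_line f v x (t : R) : (forall y, derivable f y v) ->
  exists2 th : R, `|th| <= `|t| & f (x + t *: v) - f x = t * 'D_v f (x + th *: v).
Proof.
move=> df.
pose F (s : R) := f (x + s *: v); pose dF s := 'D_v f (x + s *: v).
have dFP s : is_derive s (1 : R) F (dF s) by exact: derive_line.
have cF (A : set R) : {within A, continuous F}.
  apply: continuous_subspaceT => s; apply: differentiable_continuous.
  by apply/derivable1_diffP; case: (dFP s).
have [t0|/ltW t0] := leP 0 t.
  have [c] := @MVT_segment R F dF 0 t t0 (fun s _ => dFP s) (cF _).
  rewrite in_itv /= => /andP[c0 ct] e.
  exists c; first by rewrite !ger0_norm.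
  by move: e; rewrite /F scale0r addr0 subr0 mulrC.
have [c] := @MVT_segment R F dF t 0 t0 (fun s _ => dFP s) (cF _).
rewrite in_itv /= => /andP[c0 ct] e.
exists c; first by rewrite !ler0_norm ?lerN2.
move: e; rewrite /F scale0r addr0 sub0r /dF => e.
by rewrite -opprB e mulrN opprK mulrC.
Qed.

(** [C1] speaks of partial derivatives only. The way from [x] to [x + h] is taken one coordinate at
    a time, with the mean value theorem on each step; the intermediate points stay within [|h|] of
    [x]. Continuity and differentiability in every direction both follow from this expansion. *)
Lemma C1_telescope f : C1 f -> forall x, exists z : 'I_d -> E -> E,
  forall h : E, (forall k, `|z k h| <= `|h|) /\
    f (x + h) - f x = \sum_k h 0 k * 'D_(delta_mx 0 k) f (x + z k h).
Proof.
move=> cf x.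
(* [p h k] is [h] with the coordinates from [k] on replaced by 0. *)
pose p (h : E) (k : nat) : E := \row_i (if (i < k)%N then h 0 i else 0).
have pS h (k : 'I_d) : p h k.+1 = p h k + h 0 k *: delta_mx 0 k.
  apply/rowP => i; rewrite !mxE /= ltnS leq_eqVlt.
  have [->|/= ik] := eqVneq i k; first by rewrite eqxx ltnn mulr1 add0r.
  by rewrite (negbTE (_ : i != k :> nat)) // mulr0 addr0.
have step h (k : 'I_d) : exists w : E, `|w| <= `|h| /\
    f (x + p h k.+1) - f (x + p h k) = h 0 k * 'D_(delta_mx 0 k) f (x + w).
  have [th thh e] := @MVT_line f (delta_mx 0 k) (x + p h k) (h 0 k) (fun y => (cf k).1 y).
  exists (p h k + th *: delta_mx 0 k); split; last by rewrite pS addrA e addrA.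
  apply/rV_norm_leP => // i; rewrite !mxE /=.
  have [->|ik] := eqVneq i k.
    by rewrite ltnn add0r mulr1 (le_trans thh) // coord_le_norm.
  rewrite mulr0 addr0; case: ifP => _; last by rewrite normr0.
  exact: coord_le_norm.
have [z hz] := choice (fun hk : E * 'I_d => step hk.1 hk.2).
exists (fun k h => z (h, k)) => h; split => [k|]; first exact: (hz (h, k)).1.
have -> : x + h = x + p h d.
  by congr (_ + _); apply/rowP => i; rewrite mxE ltn_ord.
have -> : f x = f (x + p h 0%N).
  by congr f; rewrite -[LHS]addr0; congr (_ + _); apply/rowP => i; rewrite !mxE.
rewrite -(@telescope_sumr _ 0 d (fun k => f (x + p h k))) // big_mkord.
by apply: eq_bigr => k _; rewrite (hz (h, k)).2.
Qed.

(** Equivalent to [C1], by [C1_dir_C1] and [C1_C1_dir]. Having continuity and all directions at hand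
    makes closure under products and under affine substitution direct. *)
Definition C1_dir f := continuous f /\
  forall v, (forall y, derivable f y v) /\ continuous (fun y => 'D_v f y).

Lemma C1_dir_C1 f : C1_dir f -> C1 f.
Proof. by move=> [_ h] i; exact: h. Qed.

Lemma C1_derive f : C1 f ->
  forall y v, is_derive y v f (\sum_k v 0 k * 'D_(delta_mx 0 k) f y).
Proof.
move=> cf y v; have [z hz] := C1_telescope cf y.
have hS : (fun h : R => \sum_k v 0 k * 'D_(delta_mx 0 k) f (y + z k (h *: v))) @ 0^' -->
    \sum_k v 0 k * 'D_(delta_mx 0 k) f y.
  apply: cvg_sumr => k; apply: cvgMl_tmp.
  apply: (@cvg_comp _ _ _ (fun h => y + z k (h *: v)) (fun w => 'D_(delta_mx 0 k) f w) _ (nbhs (y + 0)));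
    last by rewrite addr0; exact: (cf k).2.
  apply: cvgD; first exact: cvg_cst.
  apply/norm_cvg0P.
  apply: (@squeeze_cvgr _ _ _ _ (cst 0) (fun h : R => `|h| * `|v|)).
  - by apply: nearW => h; rewrite normr_ge0 /= -normrZ (hz _).1.
  - exact: cvg_cst.
  - rewrite -[X in _ --> X](mul0r `|v|); apply: cvgMr_tmp.
    rewrite -{2}(@normr0 _ R); apply: cvg_norm; exact: cvg_within.
have h : (fun h : R => h^-1 *: ((f \o shift y) (h *: v) - f y)) @ 0^' -->
    \sum_k v 0 k * 'D_(delta_mx 0 k) f y.
  apply: cvg_trans hS; apply: near_eq_cvg; near=> h => /=.
  have h0 : h != 0 by near: h; exact: nbhs_dnbhs_neq.
  rewrite [_ + y]addrC (hz _).2 /GRing.scale /= mulr_sumr; apply: eq_bigr => k _.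
  by rewrite mxE mulrA mulKf.
by split; [apply/cvg_ex; eexists; exact: h|exact: cvg_lim h].
Unshelve. all: by end_near. Qed.

Lemma C1_continuous f : C1 f -> continuous f.
Proof.
move=> cf; apply: cvg_continuous_rV => x; have [z hz] := C1_telescope cf x.
have h : (fun h : E => f (x + h)) @ nbhs (0 : E) --> f x.
  have -> : (fun h : E => f (x + h)) =
      (fun h : E => f x + \sum_k h 0 k * 'D_(delta_mx 0 k) f (x + z k h)).
    by apply/funext => h; rewrite -(hz h).2 [RHS]addrC subrK.
  rewrite -[X in _ --> X]addr0; apply: cvgD; first exact: cvg_cst.
  rewrite -[X in _ --> X](_ : \sum_(k < d) 0 * 'D_(delta_mx 0 k) f x = 0); last first.
    by apply: big1 => k _; rewrite mul0r.
  apply: cvg_sumr => k; apply: cvgM.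
    by have := @coord_continuous R 1 d 0 k (0 : E); rewrite /continuous_at mxE.
  apply: (@cvg_comp _ _ _ (fun h => x + z k h) (fun w => 'D_(delta_mx 0 k) f w) _ (nbhs (x + 0)));
    last by rewrite addr0; exact: (cf k).2.
  apply: cvgD; first exact: cvg_cst.
  apply/norm_cvg0P.
  apply: (@squeeze_cvgr _ _ _ _ (cst 0) (fun h : E => `|h|)).
  - by apply: nearW => h; rewrite normr_ge0 /= (hz _).1.
  - exact: cvg_cst.
  - rewrite -(@normr0 _ E); apply: cvg_norm; exact: cvg_id.
have -> : f = (fun h => f (x + h)) \o (fun y => y - x).
  by apply/funext => y /=; rewrite addrC subrK.
apply: (@cvg_comp _ _ _ (fun y => y - x) (fun h => f (x + h)) _ (nbhs (0 : E)));
  last by rewrite /= subrr addr0.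
have : (fun y : E => y - x) @ nbhs x --> x - x by apply: cvgB; [exact: cvg_id|exact: cvg_cst].
by rewrite subrr.
Qed.

Lemma C1_C1_dir f : C1 f -> C1_dir f.
Proof.
move=> cf; split; first exact: C1_continuous.
move=> v; split => [y|]; first by case: (C1_derive cf y v).
have -> : (fun y => 'D_v f y) = (fun y => \sum_k v 0 k * 'D_(delta_mx 0 k) f y).
  by apply/funext => y; case: (C1_derive cf y v).
apply: cvg_continuous_rV => y; apply: cvg_sumr => k; apply: cvgMl_tmp; exact: (cf k).2.
Qed.

Lemma C1_grad f y v : C1 f -> 'D_v f y = dot (grad f y) v.
Proof.
move=> cf; case: (C1_derive cf y v) => _ ->; rewrite /dot.
by apply: eq_bigr => k _; rewrite mxE mulrC.
Qed.

End directional.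

Section C1_dir_closure.
Context {R : realType} {d : nat}.
Local Notation E := 'rV[R]_d.
Implicit Types (f g : E -> R) (v x y : E).

Lemma C1_dirI f : continuous f ->
  (forall v, exists D, continuous D /\ forall y, is_derive y v f (D y)) -> C1_dir f.
Proof.
move=> cf h; split => // v; have [D [cD dD]] := h v; split.
  by move=> y; case: (dD y).
by have -> : (fun y => 'D_v f y) = D by apply/funext => y; case: (dD y).
Qed.

Lemma C1_dir_is_derive f v y : C1_dir f -> is_derive y v f ('D_v f y).
Proof. by move=> [_ h]; split => //; exact: (h v).1. Qed.

Lemma C1_dir_affine f (L : E -> R) : continuous f ->
  (forall y v (h : R), f (y + h *: v) = f y + h * L v) -> C1_dir f.
Proof.
move=> cf hL; apply: C1_dirI => // v; exists (cst (L v)); split.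
  by move=> y; exact: cst_continuous.
by move=> y; apply: is_derive_affine => h; exact: hL.
Qed.

Lemma C1_dir_cst (c : R) : C1_dir (fun _ : E => c).
Proof.
apply: (@C1_dir_affine _ (fun _ : E => 0)); first by move=> y; exact: cst_continuous.
by move=> y v h; rewrite mulr0 addr0.
Qed.

Lemma C1_dir_coord i : C1_dir (fun x : E => x 0 i).
Proof.
apply: (@C1_dir_affine _ (fun v : E => v 0 i)); first exact: coord_continuous.
by move=> y v h; rewrite !mxE.
Qed.

Lemma C1_dirD f g : C1_dir f -> C1_dir g -> C1_dir (fun x => f x + g x).
Proof.
move=> hf hg; apply: C1_dirI.
  apply: cvg_continuous_rV => y; apply: cvgD; [exact: hf.1|exact: hg.1].
move=> v; exists (fun y => 'D_v f y + 'D_v g y); split.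
  by apply: cvg_continuous_rV => y; apply: cvgD; [exact: (hf.2 v).2|exact: (hg.2 v).2].
by move=> y; apply: is_deriveD; exact: C1_dir_is_derive.
Qed.

Lemma C1_dirM f g : C1_dir f -> C1_dir g -> C1_dir (fun x => f x * g x).
Proof.
move=> hf hg; apply: C1_dirI.
  apply: cvg_continuous_rV => y; apply: cvgM; [exact: hf.1|exact: hg.1].
move=> v; exists (fun y => f y * 'D_v g y + g y * 'D_v f y); split.
  apply: cvg_continuous_rV => y; apply: cvgD; apply: cvgM.
  - exact: hf.1.
  - exact: (hg.2 v).2.
  - exact: hg.1.
  - exact: (hf.2 v).2.
by move=> y; apply: is_deriveM; exact: C1_dir_is_derive.
Qed.

Lemma C1_dir_sum (I : Type) (s : seq I) (P : pred I) (f : I -> E -> R) :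
  (forall i, C1_dir (f i)) -> C1_dir (fun x : E => \sum_(i <- s | P i) f i x).
Proof.
move=> hf; elim: s => [|i s IH].
  by under eq_fun do rewrite big_nil; exact: C1_dir_cst.
under eq_fun do rewrite big_cons.
by case: (P i) => //; apply: C1_dirD.
Qed.

Lemma C1_dir_prod (I : Type) (s : seq I) (P : pred I) (f : I -> E -> R) :
  (forall i, C1_dir (f i)) -> C1_dir (fun x : E => \prod_(i <- s | P i) f i x).
Proof.
move=> hf; elim: s => [|i s IH].
  by under eq_fun do rewrite big_nil; exact: C1_dir_cst.
under eq_fun do rewrite big_cons.
by case: (P i) => //; apply: C1_dirM.
Qed.

Lemma C1_dirX f n : C1_dir f -> C1_dir (fun x => f x ^+ n).
Proof.
move=> hf; elim: n => [|n IH].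
  by under eq_fun do rewrite expr0; exact: C1_dir_cst.
by under eq_fun do rewrite exprS; exact: C1_dirM.
Qed.

Lemma C1_dir_poly k (p : E -> R) : is_poly k p -> C1_dir p.
Proof.
move=> [c hp].
rewrite (_ : p = fun x => \sum_(m : {ffun 'I_d -> 'I_k.+1} | (\sum_i m i <= k)%N)
            c m * \prod_i x 0 i ^+ m i); last exact/funext.
apply: C1_dir_sum => m; apply: C1_dirM; first exact: C1_dir_cst.
by apply: C1_dir_prod => i; apply: C1_dirX; exact: C1_dir_coord.
Qed.

(* The square of the positive part is convex with a 2-Lipschitz derivative. *)
Lemma sqr_pos_part_taylor (a b : R) :
  `|Num.max a 0 ^+ 2 - Num.max b 0 ^+ 2 - 2 * Num.max b 0 * (a - b)| <= (a - b) ^+ 2.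
Proof.
have sq c : 0 <= c ^+ 2 :> R by exact: sqr_ge0.
have := sq (a - b); have := sq a; have := sq b; rewrite ler_norml !expr2.
case: (leP a 0) => a0; case: (leP b 0) => b0 h1 h2 h3; apply/andP; split; try lra.
- by have := mulr_le0_ge0 a0 (ltW b0); lra.
- by have := mulr_ge0_le0 (ltW a0) b0; lra.
Qed.

(** By the Taylor bound, the difference quotient [Q h] of the square differs from
    [2 * Num.max (f y) 0 * q h] by at most [|h| * q h ^+ 2], which tends to 0. This is the building
    block of the cutoffs. *)
Lemma C1_dir_sqr_pos_part f : C1_dir f -> C1_dir (fun x => Num.max (f x) 0 ^+ 2).
Proof.
move=> hf.
have cm : continuous (fun x => Num.max (f x) 0).
  by move=> y; apply: (@continuous_max _ _ f (cst 0)); [exact: hf.1|exact: cst_continuous].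
apply: C1_dirI.
  by apply: cvg_continuous_rV => y; apply: cvgM; exact: cm.
move=> v; exists (fun y => 2 * Num.max (f y) 0 * 'D_v f y); split.
  apply: cvg_continuous_rV => y; apply: cvgM; last exact: (hf.2 v).2.
  by apply: cvgMl_tmp; exact: cm.
move=> y.
pose q (h : R) := h^-1 *: ((f \o shift y) (h *: v) - f y).
have cq : q @ 0^' --> 'D_v f y by exact: (hf.2 v).1.
pose F x := Num.max (f x) 0 ^+ 2.
pose Q (h : R) := h^-1 *: ((F \o shift y) (h *: v) - F y).
have cr : (fun h => Q h - 2 * Num.max (f y) 0 * q h) @ 0^' --> (0 : R).
  apply/norm_cvg0P.
  apply: (@squeeze_cvgr _ _ _ _ (cst 0) (fun h : R => `|h| * (q h * q h))).
  - near=> h; rewrite normr_ge0 /=.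
    have h0 : h != 0 by near: h; exact: nbhs_dnbhs_neq.
    rewrite /Q /q /F /= /GRing.scale /=.
    set a := f _; set b := f y.
    have -> : h^-1 * (Num.max a 0 ^+ 2 - Num.max b 0 ^+ 2) - 2 * Num.max b 0 * (h^-1 * (a - b))
      = h^-1 * (Num.max a 0 ^+ 2 - Num.max b 0 ^+ 2 - 2 * Num.max b 0 * (a - b)) by ring.
    have -> : `|h| * (h^-1 * (a - b) * (h^-1 * (a - b))) = `|h|^-1 * (a - b) ^+ 2.
      have -> : h^-1 * (a - b) * (h^-1 * (a - b)) = (`|h| ^+ 2)^-1 * (a - b) ^+ 2.
        by rewrite real_normK ?num_real//; field.
      by field; rewrite normr_eq0.
    rewrite normrM normfV ler_pM2l ?invr_gt0 ?normr_gt0 //.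
    exact: sqr_pos_part_taylor.
  - exact: cvg_cst.
  - rewrite -[X in _ --> X](mul0r ('D_v f y * 'D_v f y)); apply: cvgM; last exact: cvgM.
    rewrite -{2}(@normr0 _ R); apply: cvg_norm; exact: cvg_within.
have cQ : Q @ 0^' --> 2 * Num.max (f y) 0 * 'D_v f y.
  have -> : Q = fun h => (Q h - 2 * Num.max (f y) 0 * q h) + 2 * Num.max (f y) 0 * q h.
    by apply/funext => h; rewrite subrK.
  rewrite -[X in _ --> X]add0r; apply: cvgD => //; exact: cvgMl_tmp.
by split; [apply/cvg_ex; eexists; exact: cQ|exact: cvg_lim cQ].
Unshelve. all: by end_near. Qed.

Lemma derive_out_of_support f v x : ~ closure [set y | f y != 0] x -> 'D_v f x = 0.
Proof.
move=> nx; rewrite (@near_eq_derive _ _ _ f (cst 0)) ?derive_cst//.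
have : nbhs x (~` closure [set y | f y != 0]).
  by apply: open_nbhs_nbhs; split => //; apply: closed_openC; exact: closed_closure.
apply: filterS => y ny; apply/eqP; apply: contra_notT ny => fy.
exact: subset_closure.
Qed.

Lemma nonzero_derive_isolated_zero (F : R -> R) (s D : R) :
  is_derive s (1 : R) F D -> D != 0 -> F s = 0 ->
  exists2 V, nbhs s V & forall t, V t -> F t = 0 -> t = s.
Proof.
move=> [dF <-] D0 Fs.
have h : (fun h : R => h^-1 *: ((F \o shift s) (h *: (1 : R)) - F s)) @ 0^' --> 'D_1 F s.
  exact: dF.
have : \forall h \near 0^', h^-1 *: ((F \o shift s) (h *: (1 : R)) - F s) != 0.
  by apply: (h [set y | y != 0]); apply: open_nbhs_nbhs; split => //; exact: open_neq.
move=> /nbhs_ballP[e /= e0 he].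
exists (ball s e); first exact: nbhsx_ballx.
move=> t tV Ft; apply/eqP; apply/negPn/negP => ts.
have /he : ball 0 e (t - s) by rewrite /ball /= sub0r normrN distrC.
rewrite subr_eq0 => /(_ ts); rewrite /= Fs subr0 [_ *: 1]mulr1 subrK Ft scaler0.
by rewrite eqxx.
Qed.

Lemma C1_zero_set f : C1 f ->
  measurable [set x | f x = 0 /\ grad f x != 0] /\
  leb d [set x | f x = 0 /\ grad f x != 0] = 0%E.
Proof.
move=> cf; have [cf0 cf1] := C1_C1_dir cf.
pose Z (i : 'I_d) := [set x | f x = 0 /\ 'D_(delta_mx 0 i) f x != 0].
have mZ i : measurable (Z i).
  have -> : Z i = (f @^-1` [set 0]) `&` ~` ((fun x => 'D_(delta_mx 0 i) f x) @^-1` [set 0]).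
    by apply/seteqP; split => x [fx /eqP dx]; split => //; exact/eqP.
  apply: measurableI; last apply: measurableC.
    have := continuous_measurable_rV cf0 measurableT (measurable_set1 0).
    by rewrite setTI.
  have := continuous_measurable_rV (cf i).2 measurableT (measurable_set1 0).
  by rewrite setTI.
have Z0 i : leb d (Z i) = 0%E.
  apply: (null_countable_slices (i := i)) => // x.
  (* A set of reals has countably many isolated points, and here every point of the slice is
     isolated because the derivative along the line does not vanish there. *)
  apply: sub_countable (countable_isolated [set s : R | Z i (x + s *: delta_mx 0 i)]).
  apply: subset_card_le => s [/= fs ds].
  split; first by rewrite inE.
  have dF := derive_line ((cf i).1 (x + s *: delta_mx 0 i)).
  have [V V0 hV] := nonzero_derive_isolated_zero dF ds fs.
  exists V => //; apply/seteqP; split => [t [Vt [ft _]]|_ ->]; first exact: hV.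
  by split => //; exact: nbhs_singleton.
have -> : [set x | f x = 0 /\ grad f x != 0] = \big[setU/set0]_(i < d) Z i.
  apply/seteqP; rewrite -bigcup_seq; split => [x [fx gx]|x [i _ [fx di]]]; last first.
    split => //; apply: contra_neq di => /rowP /(_ i); rewrite !mxE; exact.
  have [i hi] : exists i, 'D_(delta_mx 0 i) f x != 0.
    apply/not_existsP => h; move/negP: gx; apply; apply/eqP/rowP => i; rewrite !mxE.
    by apply/eqP/negPn/negP => h'; exact: (h i).
  by exists i => //=; rewrite mem_index_enum.
by split; [exact: bigsetU_measurable|exact: measure_fin_bigsetU0].
Qed.

End C1_dir_closure.

Section C1_dir_comp.
Context {R : realType}.

Lemma C1_dir_comp_affine n m (f : 'rV[R]_m -> R) (A L : 'rV[R]_n -> 'rV[R]_m) :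
  continuous A -> (forall x w (h : R), A (x + h *: w) = A x + h *: L w) ->
  C1_dir f -> C1_dir (f \o A) /\
    forall w x, 'D_w (f \o A) x = 'D_(L w) f (A x).
Proof.
move=> cA hA hf.
have dA w x : is_derive x w (f \o A) ('D_(L w) f (A x)).
  have eqf : (fun h : R => h^-1 *: (((f \o A) \o shift x) (h *: w) - (f \o A) x)) =
     (fun h : R => h^-1 *: ((f \o shift (A x)) (h *: L w) - f (A x))).
    by apply/funext => h /=; rewrite [_ + x]addrC hA [_ + A x]addrC.
  by split; rewrite /derivable /derive eqf //; exact: (hf.2 (L w)).1.
split; last by move=> w x; case: (dA w x).
apply: C1_dirI.
  by move=> x; apply: continuous_comp; [exact: cA|exact: hf.1].
move=> w; exists (fun x => 'D_(L w) f (A x)); split => // x.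
apply: (@continuous_comp _ _ _ A (fun y => 'D_(L w) f y)); [exact: cA|exact: (hf.2 (L w)).2].
Qed.

End C1_dir_comp.

(** * Barycentric coordinates *)

Section dot.
Context {R : realType} {d : nat}.
Local Notation E := 'rV[R]_d.
Implicit Types (x y z : E).

Lemma dotC x y : dot x y = dot y x.
Proof. by apply: eq_bigr => i _; rewrite mulrC. Qed.

Lemma dotDr x y z : dot x (y + z) = dot x y + dot x z.
Proof. by rewrite /dot -big_split; apply: eq_bigr => i _; rewrite mxE mulrDr. Qed.

Lemma dotZr (c : R) x y : dot x (c *: y) = c * dot x y.
Proof. by rewrite /dot mulr_sumr; apply: eq_bigr => i _; rewrite mxE mulrCA. Qed.

Lemma dotBr x y z : dot x (y - z) = dot x y - dot x z.
Proof. by rewrite dotDr -scaleN1r dotZr mulN1r. Qed.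

Lemma dotZl (c : R) x y : dot (c *: x) y = c * dot x y.
Proof. by rewrite dotC dotZr dotC. Qed.

Lemma dot_ge0 x : 0 <= dot x x.
Proof. by apply: sumr_ge0 => i _; rewrite -expr2 sqr_ge0. Qed.

Lemma dot_eq0 x : dot x x = 0 -> x = 0.
Proof.
move=> /eqP; rewrite psumr_eq0 => [/allP h|j _]; last by rewrite -expr2 sqr_ge0.
apply/rowP => i; rewrite mxE.
by have := h i (mem_index_enum i); rewrite /= mulf_eq0 orbb => /eqP.
Qed.

Lemma dot0r x : dot x 0 = 0.
Proof. by rewrite /dot big1 // => i _; rewrite mxE mulr0. Qed.

End dot.

Section barycentric.
Context {R : realType} {d : nat} (V : 'M[R]_(d.+1, d)).
Hypothesis affV : aff_indep V.
Local Notation E := 'rV[R]_d.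
Implicit Types (x y v : E).

Let B : 'M[R]_d.+1 := row_mx (const_mx 1 : 'M[R]_(d.+1, 1)) V.

Let B_unit : B \in unitmx.
Proof. by rewrite -row_free_unit. Qed.

(** The linear part of the affine map [bary V]: the homogeneous coordinate 1 of a point becomes the
    0 of a vector. *)
Definition bary_lin v : 'rV[R]_d.+1 := row_mx (0 : 'M[R]_(1, 1)) v *m invmx B.

Lemma bary_mulmx x : bary V x *m V = x /\ \sum_i bary V x 0 i = 1.
Proof.
have h : bary V x *m B = row_mx (const_mx 1 : 'M[R]_(1, 1)) x.
  by rewrite /bary -mulmxA mulVmx // mulmx1.
move: h; rewrite /B (mul_mx_row (bary V x) (const_mx 1 : 'M[R]_(d.+1, 1)) V).
move=> /(@eq_row_mx _ 1 1 d)[h ->]; split => //.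
move/rowP: h => /(_ 0); rewrite [RHS]mxE mxE => <-.
by apply: eq_bigr => i _; rewrite [const_mx _ _ _]mxE mulr1.
Qed.

Lemma bary_uniq (w : 'rV[R]_d.+1) : \sum_i w 0 i = 1 -> bary V (w *m V) = w.
Proof.
move=> w1; rewrite /bary.
have -> : row_mx (const_mx 1 : 'M[R]_(1, 1)) (w *m V) = w *m B.
  rewrite /B (mul_mx_row w (const_mx 1 : 'M[R]_(d.+1, 1)) V); congr row_mx; apply/rowP => i; rewrite !mxE -[LHS]w1.
  by apply: eq_bigr => j _; rewrite mxE mulr1.
by rewrite -mulmxA mulmxV // mulmx1.
Qed.

Lemma baryD x v (h : R) : bary V (x + h *: v) = bary V x + h *: bary_lin v.
Proof.
rewrite /bary /bary_lin scalemxAl -mulmxDl; congr (_ *m _).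
by rewrite scale_row_mx add_row_mx scaler0 addr0.
Qed.

Lemma bary_linN v : bary_lin (- v) = - bary_lin v.
Proof. by rewrite /bary_lin -mulNmx opp_row_mx oppr0. Qed.

Lemma baryE x y (i : 'I_d.+1) : bary V (x + y) 0 i = bary V x 0 i + bary_lin y 0 i.
Proof. by rewrite -[y]scale1r baryD !scale1r mxE. Qed.

Lemma bary_lin_mulmx v : bary_lin v *m V = v /\ \sum_i bary_lin v 0 i = 0.
Proof.
have [h1 h2] := bary_mulmx 0; have [h3 h4] := bary_mulmx (0 + 1 *: v).
split; first by move: h3; rewrite baryD scale1r mulmxDl h1 !add0r scale1r.
move: h4; rewrite baryD scale1r; under eq_bigr do rewrite mxE.
by rewrite big_split /= h2 => /(canRL (addKr _)); rewrite addNr.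
Qed.

Lemma bary_vertex i : bary V (row i V) = delta_mx 0 i.
Proof.
rewrite rowE; apply: bary_uniq; rewrite (bigD1 i) //= mxE !eqxx big1 ?addr0 // => j ji.
by rewrite mxE (negbTE ji) andbF.
Qed.

Lemma bary_lin_edge a b : bary_lin (row a V - row b V) = delta_mx 0 a - delta_mx 0 b.
Proof.
have := baryD (row b V) (row a V - row b V) 1.
by rewrite !scale1r subrKC !bary_vertex => ->; rewrite [RHS]addrC addKr.
Qed.

Lemma simplexE : simplex V = [set x | forall i, 0 <= bary V x 0 i].
Proof.
apply/seteqP; split => [x [w [w0 _ w1] <-] i|x x0].
  by rewrite bary_uniq.
have [h1 h2] := bary_mulmx x.
by exists (bary V x) => //; split.
Qed.

Lemma bary_coordE x i : bary V x 0 i = invmx B ord0 i + \sum_j x 0 j * invmx B (rshift 1 j) i.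
Proof.
rewrite /bary mxE (@big_split_ord _ _ _ 1 d) /= big_ord1; congr (_ + _).
  by rewrite row_mxEl mxE mul1r; congr (invmx B _ i); exact: val_inj.
by apply: eq_bigr => j _; rewrite row_mxEr.
Qed.

Lemma C1_dir_bary i : C1_dir (fun x => bary V x 0 i).
Proof.
apply: (@C1_dir_affine _ _ _ (fun v => bary_lin v 0 i)); last first.
  by move=> y v h; rewrite baryD !mxE.
apply: cvg_continuous_rV => x; under eq_fun do rewrite bary_coordE.
rewrite bary_coordE; apply: cvgD; first exact: cvg_cst.
by apply: cvg_sumr => j; apply: cvgMr_tmp; exact: coord_continuous.
Qed.

Lemma bary_continuous i : continuous (fun x => bary V x 0 i).
Proof. by case: (C1_dir_bary i). Qed.

Lemma derive_bary i v y : 'D_v (fun x => bary V x 0 i) y = bary_lin v 0 i.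
Proof.
have : is_derive y v (fun x => bary V x 0 i) (bary_lin v 0 i).
  by apply: is_derive_affine => h; rewrite baryD !mxE.
by case.
Qed.

(** Stands for the interior: it is open and differs from [simplex V] by a subset of the null set
    [bary_zeros], so integrals over it, over the interior and over the closed simplex coincide. *)
Definition osimplex : set E := [set x | forall i, 0 < bary V x 0 i].

Lemma open_osimplex : open osimplex.
Proof.
rewrite openE => x ox; apply: (@filter_forall _ _ _ (nbhs x)) => i.
apply: (@bary_continuous i x [set y | 0 < y]).
by apply: open_nbhs_nbhs; split; [exact: (@open_gt _ 0)|exact: ox].
Qed.

Lemma osimplex_sub_simplex : osimplex `<=` simplex V.
Proof. by rewrite simplexE => x h i; exact: ltW. Qed.

Lemma osimplex_sub_interior : osimplex `<=` interior (simplex V).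
Proof.
rewrite -(open_subsetE _ open_osimplex); exact: osimplex_sub_simplex.
Qed.

Lemma osimplex_nonempty : osimplex !=set0.
Proof.
exists ((const_mx d.+1%:R^-1) *m V) => i.
have w1 : \sum_i (const_mx d.+1%:R^-1 : 'rV[R]_d.+1) 0 i = 1.
  under eq_bigr do rewrite mxE.
  by rewrite sumr_const card_ord -[LHS]mulr_natl mulfV // pnatr_eq0.
by rewrite bary_uniq // mxE invr_gt0.
Qed.

Lemma closed_simplex : closed (simplex V).
Proof.
rewrite simplexE.
have -> : [set x | forall i, 0 <= bary V x 0 i] =
    \bigcap_(i in setT) [set x | 0 <= bary V x 0 i].
  by apply/seteqP; split => x /= h i => [_|]; exact: h.
apply: closed_bigI => i _.
by apply: (closed_comp _ (@closed_ge _ 0)) => x _; exact: bary_continuous.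
Qed.

Lemma simplex_bounded : exists M : R, forall x, simplex V x -> forall j, `|x 0 j| <= M.
Proof.
exists (\sum_i \sum_j `|V i j|) => x; rewrite simplexE => x0 j.
have [e s1] := bary_mulmx x; rewrite -{1}e.
rewrite mxE (le_trans (ler_norm_sum _ _ _)) //; apply: ler_sum => i _.
rewrite normrM (ger0_norm (x0 i)).
apply: (@le_trans _ _ `|V i j|).
  rewrite ler_piMl // -s1 (bigD1 i) //= lerDl; exact: sumr_ge0.
by rewrite (bigD1 j) //= lerDl; exact: sumr_ge0.
Qed.

End barycentric.

Section affine_null.
Context {R : realType} {d : nat}.

(** The gradient of a nonconstant affine function vanishes nowhere, so all of its zeros are regular
    and [C1_zero_set] applies. *)
Lemma affine_zero_null (f L : 'rV[R]_d -> R) (v : 'rV[R]_d) : continuous f ->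
  (forall y v (h : R), f (y + h *: v) = f y + h * L v) -> L v != 0 ->
  measurable [set x | f x = 0] /\ leb d [set x | f x = 0] = 0%E.
Proof.
move=> cf hL Lv; have c1 := C1_dir_C1 (C1_dir_affine cf hL).
have -> : [set x | f x = 0] = [set x | f x = 0 /\ grad f x != 0].
  apply/seteqP; split => [x h|x [] //]; split => //; apply/eqP => g0.
  have [_ D] : is_derive x v f (L v) by apply: is_derive_affine => h'; exact: hL.
  by move: Lv; rewrite -D (C1_grad _ _ c1) g0 dotC dot0r eqxx.
exact: C1_zero_set.
Qed.

End affine_null.

Section gram.
Context {R : realType}.

Lemma dot_trmx d (x y : 'rV[R]_d) : (x *m y^T) 0 0 = dot x y.
Proof. by rewrite mxE; apply: eq_bigr => i _; rewrite mxE. Qed.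

(* The characteristic polynomial of [- A A^T] is monic without nonnegative root. *)
Lemma det_gram_gt0 m d (A : 'M[R]_(m, d)) : row_free A -> 0 < \det (A *m A^T).
Proof.
move=> fA; pose p := char_poly (- (A *m A^T)).
have p0 : p.[0] = \det (A *m A^T).
  rewrite horner_coef0 char_poly_det -[X in \det X]scaleN1r detZ mulrA -expr2 sqrr_sign.
  by rewrite mul1r.
have nr s : 0 <= s -> ~~ root p s.
  move=> s0; rewrite -eigenvalue_root_char; apply/eigenvalueP => -[v hv v0].
  have h : dot (v *m A) (v *m A) = - s * dot v v.
    rewrite -!dot_trmx trmx_mul mulmxA -(mulmxA v).
    have -> : v *m (A *m A^T) = - (s *: v) by rewrite -hv mulmxN opprK.
    by rewrite mulNmx -scalemxAl -scaleNr [LHS]mxE.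
  have /dot_eq0 vA : dot (v *m A) (v *m A) = 0.
    by apply/eqP; rewrite eq_le dot_ge0 andbT h mulNr oppr_le0 mulr_ge0 // dot_ge0.
  by move/negP: v0; apply; apply/eqP; apply: (row_free_inj fA); rewrite vA mul0mx.
rewrite ltNge; apply/negP => det0.
have [b hb] := monic_Cauchy_bound (char_poly_monic (- (A *m A^T))).
have b0 : 0 <= Num.max b 0 by rewrite le_max lexx orbT.
have pb : p.[0] <= 0 <= p.[Num.max b 0].
  by rewrite p0 det0 ltW //; apply: hb; rewrite le_max lexx.
have [s /andP[s0 _] rs] := Num.poly_ivt b0 pb.
by move: (nr s s0); rewrite rs.
Qed.

End gram.

(** * Faces of a simplex and their outward normals *)

Section faces.
Context {R : realType} {n : nat} (V : 'M[R]_(n.+2, n.+1)).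
Hypothesis affV : aff_indep V.
Local Notation E := 'rV[R]_n.+1.
Implicit Types (x y v g : E) (i a b c : 'I_n.+2).

(** A vector orthogonal to a face is a multiple of the gradient of the barycentric coordinate
    vanishing there. Indeed [v] is the combination of the vertices with weights [bary_lin V v]; the
    weights sum to 0 and [dot g] is constant on the vertices other than [i], so only the term at [i]
    survives. *)
Lemma dot_face_orthogonal g i :
  (forall a b, a != i -> b != i -> dot g (row a V - row b V) = 0) ->
  forall a, a != i -> forall v,
    dot g v = - dot g (row a V - row i V) * bary_lin V v 0 i.
Proof.
move=> hg a ai v; have [e s0] := bary_lin_mulmx affV v.
have dotE w : dot g (w *m V) = \sum_b w 0 b * dot g (row b V).
  rewrite mulmx_sum_row; elim/big_rec2: _ => [|b y1 y2 _ <-]; first exact: dot0r.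
  by rewrite dotDr dotZr.
rewrite -{1}e dotE.
have -> : \sum_b bary_lin V v 0 b * dot g (row b V) =
   \sum_b bary_lin V v 0 b * (dot g (row b V) - dot g (row a V)).
  under [RHS]eq_bigr do rewrite mulrBr.
  by rewrite sumrB -mulr_suml s0 mul0r subr0.
rewrite (bigD1 i) //= big1 => [|b bi]; last by rewrite -dotBr hg // mulr0.
by rewrite addr0 mulrC dotBr opprB.
Qed.

Lemma exists_neq_ord i : exists a, a != i.
Proof. by exists (lift i ord0); rewrite eq_sym neq_lift. Qed.

Definition is_outward_normal i (nu : E) := [/\ enorm nu = 1,
    forall a b, a != i -> b != i -> dot nu (row a V - row b V) = 0 &
    forall a, a != i -> 0 < dot nu (row a V - row i V)].

(** [outward_normal] is picked by [xget] with default value 0, so a unit outward normal has to be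
    exhibited. *)
Lemma outward_normalP i : is_outward_normal i (outward_normal V i).
Proof.
pose B : 'M[R]_n.+2 := row_mx (const_mx 1 : 'M[R]_(n.+2, 1)) V.
(* Minus the gradient of the [i]-th barycentric coordinate; the first row of [invmx B] holds the
   constant terms and is skipped. *)
pose w : E := \row_j (- invmx B (rshift 1 j) i).
have hw v : dot w v = - bary_lin V v 0 i.
  rewrite /bary_lin mxE (@big_split_ord _ _ _ 1 n.+1) /= big_ord1 row_mxEl [_ 0 0]mxE mul0r add0r.
  rewrite -sumrN; apply: eq_bigr => j _; rewrite row_mxEr mxE.
  by rewrite mulrC mulrN.
have [a ai] := exists_neq_ord i.
have w1 b : b != i -> dot w (row b V - row i V) = 1.
  by move=> bi; rewrite hw bary_lin_edge // !mxE !eqxx (eq_sym i) (negbTE bi) /= sub0r opprK.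
have w0 : 0 < dot w w.
  rewrite lt_def dot_ge0 andbT; apply/eqP => /dot_eq0 e.
  by have /eqP := w1 a ai; rewrite e dotC dot0r eq_sym oner_eq0.
pose r := (Num.sqrt (dot w w))^-1.
have r0 : 0 < r by rewrite invr_gt0 sqrtr_gt0.
suff h : exists nu, is_outward_normal i nu by exact: (@xgetPex _ 0 (is_outward_normal i) h).
exists (r *: w); split.
- rewrite /enorm dotZl dotZr mulrA -expr2 sqrtrM ?sqr_ge0 // sqrtr_sqr gtr0_norm //.
  by rewrite /r mulVf // gt_eqF // sqrtr_gt0.
- move=> b c bi ci; rewrite dotZl hw bary_lin_edge // !mxE.
  by rewrite !(eq_sym i) (negbTE bi) (negbTE ci) !andbF subrr oppr0 mulr0.
- by move=> b bi; rewrite dotZl w1 // mulr1.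
Qed.

(** [dot_face_orthogonal] with both vectors equal to [nu] reads [1 = - k * l] with [k > 0]. *)
Lemma bary_lin_normal_lt0 i nu : is_outward_normal i nu -> bary_lin V nu 0 i < 0.
Proof.
move=> [n1 n2 n3]; have [a ai] := exists_neq_ord i.
have := dot_face_orthogonal n2 ai nu.
have -> : dot nu nu = 1.
  by rewrite -[LHS]sqr_sqrtr ?dot_ge0 // -/(enorm nu) n1 expr1n.
by have := n3 a ai; set k := dot _ _; set l := bary_lin _ _ _ _; nra.
Qed.

Lemma face_normal_span i nu g : is_outward_normal i nu ->
  (forall a b, a != i -> b != i -> dot g (row a V - row b V) = 0) ->
  dot g nu = 0 -> g = 0.
Proof.
move=> hn hg gn; have [a ai] := exists_neq_ord i.
have h := dot_face_orthogonal hg ai.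
have k0 : dot g (row a V - row i V) = 0.
  move/eqP: (h nu); rewrite gn eq_sym mulf_eq0 oppr_eq0 => /orP[/eqP //|].
  by rewrite lt_eqF // bary_lin_normal_lt0.
by apply: dot_eq0; rewrite h k0 oppr0 mul0r.
Qed.

Lemma face_point_bary i (t : 'rV[R]_n) :
  let y := row ord0 (row' i V) + t *m edges (row' i V) in
  [/\ bary V y 0 i = 0, bary V y 0 (lift i ord0) = 1 - \sum_j t 0 j &
      forall j, bary V y 0 (lift i (lift ord0 j)) = t 0 j].
Proof.
move=> y.
pose w c : R := if unlift i c is Some c' then
   (if unlift ord0 c' is Some j then t 0 j else 1 - \sum_j t 0 j) else 0.
have w1 : \sum_c w c = 1.
  rewrite (bigD1_ord i) //= {1}/w unlift_none add0r big_ord_recl /w liftK unlift_none.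
  rewrite [X in _ + X = _](eq_bigr (fun j => t 0 j)) => [|j _]; first by rewrite subrK.
  by rewrite liftK liftK.
have -> : y = (\row_c w c) *m V.
  rewrite /y !mulmx_sum_row (bigD1_ord i) //= mxE {1}/w unlift_none scale0r add0r.
  rewrite big_ord_recl !mxE /w liftK unlift_none.
  rewrite [X in _ = _ + X](eq_bigr (fun j => t 0 j *: row (lift i (lift ord0 j)) V)); last first.
    by move=> j _; rewrite mxE liftK liftK.
  have eF (c : 'I_n.+1) : row (lift i c) V = row c (row' i V) by apply/rowP => k; rewrite !mxE.
  rewrite scalerBl scale1r eF -addrA; congr (_ + _).
  rewrite addrC scaler_suml -sumrB; apply: eq_bigr => j _.
  by rewrite rowK scalerBr eF.
rewrite bary_uniq //; last by under eq_bigr do rewrite mxE.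
by split => [||j]; rewrite mxE /w ?unlift_none // ?liftK ?unlift_none ?liftK.
Qed.

(** The parameters are barycentric coordinates of the face point, so [t *m edges (row' i V)]
    determines [t]. This makes the surface element positive. *)
Lemma row_free_edges i : row_free (edges (row' i V)).
Proof.
apply: inj_row_free => t t0.
pose y (t : 'rV[R]_n) := row ord0 (row' i V) + t *m edges (row' i V).
have [_ _ h1] := face_point_bary i t; have [_ _ h2] := face_point_bary i 0.
apply/rowP => j; rewrite -h1 -h2; congr (bary V (_ + _) _ _).
by rewrite t0 mul0mx.
Qed.

Lemma face_orthogonal_edges i g :
  (forall j, dot g (row j (edges (row' i V))) = 0) ->
  forall a b, a != i -> b != i -> dot g (row a V - row b V) = 0.
Proof.
move=> hg.
have eF (c : 'I_n.+1) : row (lift i c) V = row c (row' i V) by apply/rowP => k; rewrite !mxE.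
have key (c : 'I_n.+1) : dot g (row c (row' i V)) = dot g (row ord0 (row' i V)).
  case: (unliftP ord0 c) => [j|] -> //.
  by apply/eqP; rewrite -subr_eq0 -dotBr -[X in dot g X](rowK (fun j => row (lift ord0 j) (row' i V) - row ord0 (row' i V))) hg.
move=> a b; rewrite eq_sym => /unlift_some[a' -> _]; rewrite eq_sym => /unlift_some[b' -> _].
by rewrite !eF dotBr !key subrr.
Qed.

Lemma bary_null i : measurable [set x | bary V x 0 i = 0] /\
  leb n.+1 [set x | bary V x 0 i = 0] = 0%E.
Proof.
have [a ai] := exists_neq_ord i.
apply: (@affine_zero_null _ _ _ (fun v => bary_lin V v 0 i) (row i V - row a V)).
- exact: bary_continuous.
- by move=> y v h; rewrite baryD !mxE.
- by rewrite bary_lin_edge // !mxE !eqxx (eq_sym i) (negbTE ai) /= subr0 oner_eq0.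
Qed.

Definition bary_zeros : set E := \big[setU/set0]_(i < n.+2) [set x | bary V x 0 i = 0].

Lemma bary_zeros_null : measurable bary_zeros /\ leb n.+1 bary_zeros = 0%E.
Proof.
split; first by apply: bigsetU_measurable => i _; exact: (bary_null i).1.
by apply: measure_fin_bigsetU0 => i; [exact: (bary_null i).1|exact: (bary_null i).2].
Qed.

Lemma simplex_bary_zeros x : simplex V x -> ~ bary_zeros x -> osimplex V x.
Proof.
rewrite simplexE // => x0 nz i; rewrite lt_def x0 andbT; apply/eqP => xi.
by apply: nz; rewrite /bary_zeros -bigcup_seq; exists i => //=; rewrite mem_index_enum.
Qed.

End faces.

(** * The flux of the exact solution *)

Section Lfun2.
Context d (T : measurableType d) (R : realType) (mu : {measure set T -> \bar R}).

Lemma Lfun2_restrict (U : set T) (f : T -> R) : measurable U ->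
  f \in Lfun mu 2%:E -> f \_ U \in Lfun mu 2%:E.
Proof.
move=> mU /[!inE] /andP[/[!inE]/= mf lf]; apply/andP.
have mfU : measurable_fun setT (f \_ U).
  by apply/(measurable_restrictT _ mU); exact: measurable_funTS.
split; first by rewrite inE.
move: lf; rewrite !inE /= /finite_norm; apply: le_lt_trans.
rewrite unlock gt0_ler_poweR //.
- by rewrite in_itv /= leey integral_ge0 // => x _; exact: poweR_ge0.
- by rewrite in_itv /= leey integral_ge0 // => x _; exact: poweR_ge0.
have mp (g : T -> R) : measurable_fun setT g ->
    measurable_fun setT (fun x => (`|(g x)%:E| `^ 2)%E).
  move=> mg; apply/measurable_EFinP.
  apply: (@measurableT_comp _ _ _ _ _ _ (fun x : R => x `^ 2)%R) => //.
  exact/measurableT_comp.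
rewrite ge0_le_integral //.
- by move=> x _; exact: poweR_ge0.
- exact: mp.
- exact: mp.
move=> x _ /=; rewrite lee_fin /patch; case: ifP => // _.
by rewrite normr0 powR0 ?powR_ge0 // pnatr_eq0.
Qed.

Lemma Lfun2_integrable_on (U : set T) (f : T -> R) : measurable U ->
  (mu U < +oo)%E -> f \_ U \in Lfun mu 2%:E -> mu.-integrable U (EFin \o f).
Proof.
move=> mU fU Lf.
have mf : measurable_fun U f.
  apply/(measurable_restrictT _ mU).
  by move: Lf; rewrite inE => /andP[/[!inE]].
have i2 := integrableS measurableT mU (@subsetT _ _) (Lfun2_integrable_sqr Lf).
have i1 : mu.-integrable U (EFin \o cst 1).
  by apply: measurable_bounded_integrable => //; exact: bounded_cst.
(* Domination of [|f|] by [1 + f ^+ 2], where the constant is integrable because [U] has finite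
   measure. *)
apply: le_integrable (integrableD mU i1 i2) => //; first exact/measurable_EFinP.
move=> x Ux /=; rewrite patchE mem_set // lee_fin.
apply: le_trans (ler_norm _); rewrite -[f x ^+ 2]real_normK ?num_real //.
have := sqr_ge0 (`|f x| - 1); have := normr_ge0 (f x).
by set a := `|f x|; nra.
Qed.

Lemma cvg_Rintegral_cutoff (D : set T) (g : T -> R) (phi : nat -> T -> R) :
  measurable D -> mu.-integrable D (EFin \o g) ->
  (forall m, measurable_fun D (phi m)) ->
  (forall m x, 0 <= phi m x <= 1) ->
  (forall x, D x -> (fun m => phi m x) @ \oo --> (1 : R)) ->
  (fun m => \int[mu]_(x in D) (g x * phi m x)) @ \oo --> \int[mu]_(x in D) g x.
Proof.
move=> mD ig mphi phi01 phi1.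
have /integrableP[/measurable_EFinP mg _] := ig.
apply: fine_cvg; rewrite fineK; last exact: integrable_fin_num.
have mf_ m : measurable_fun D (fun x => (g x * phi m x)%:E).
  by apply/measurable_EFinP; exact: measurable_funM.
have mf : measurable_fun D (EFin \o g) by exact/measurable_EFinP.
have cf : {ae mu, forall x, D x -> (fun m => (g x * phi m x)%:E) @ \oo --> (EFin \o g) x}.
  apply: aeW => x Dx; apply: cvg_EFin; first exact: nearW.
  by rewrite -[X in _ --> X]mulr1; apply: cvgMl_tmp; exact: phi1.
have dom : {ae mu, forall x m, D x -> (`|(g x * phi m x)%:E| <= (abse \o (EFin \o g)) x)%E}.
  apply: aeW => x m Dx; rewrite /= lee_fin normrM ler_piMr //.
  by have /andP[h0 h1] := phi01 m x; rewrite ger0_norm.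
by have [] := dominated_convergence mD mf_ mf cf (integrable_abse ig) dom.
Qed.

Lemma Rintegral_sub_support (D U : set T) (F : T -> R) : U `<=` D ->
  (forall x, ~ U x -> F x = 0) ->
  \int[mu]_(x in D) F x = \int[mu]_(x in U) F x.
Proof.
move=> UD F0; rewrite Rintegral_mkcond [RHS]Rintegral_mkcond.
apply: eq_Rintegral => x _; rewrite /patch.
case: (pselect (U x)) => Ux; first by rewrite !mem_set //; exact: UD.
by rewrite (memNset Ux); case: ifP => // _; exact: F0.
Qed.

Lemma Rintegral_setD_null (D N D' : set T) (f : T -> R) :
  measurable N -> mu N = 0%E -> D `\` N `<=` D' -> D' `<=` D ->
  \int[mu]_(x in D) f x = \int[mu]_(x in D') f x.
Proof. by move=> mN N0 DN DD; congr fine; exact: integral_setD_null mN N0 DN DD. Qed.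

End Lfun2.

(** * Cutoff functions of a simplex *)

Section cutoff.
Context {R : realType} {n : nat} (V : 'M[R]_(n.+2, n.+1)).
Hypothesis affV : aff_indep V.
Local Notation E := 'rV[R]_n.+1.

(** The squared positive part of [1 - x], applied twice: a C^1 step that is 0 for [z <= 0] and 1 for
    [z >= 1]. *)
Definition C1_step (z : R) : R := Num.max (1 - Num.max (1 - z) 0 ^+ 2) 0 ^+ 2.

Lemma C1_step_ge1 z : 1 <= z -> C1_step z = 1.
Proof.
move=> z1; rewrite /C1_step; have -> : Num.max (1 - z) 0 = 0 by rewrite max_r // subr_le0.
by rewrite expr0n subr0 max_l ?expr1n.
Qed.

Lemma C1_step_le0 z : z <= 0 -> C1_step z = 0.
Proof.
move=> z0; have z1 : 0 <= 1 - z by lra.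
by rewrite /C1_step (max_l z1) max_r ?expr0n //; nra.
Qed.

Lemma C1_step01 z : 0 <= C1_step z <= 1.
Proof.
rewrite /C1_step sqr_ge0 /= expr_le1 // ?le_max ?lexx ?orbT //.
by rewrite ge_max ler01 andbT gerBl sqr_ge0.
Qed.

(** A factor is 0 where its coordinate is at most 1/(m+1) and 1 where it is at least 2/(m+1). The
    shift by 1 keeps the closed support inside the open simplex. *)
Definition cutoff (m : nat) (x : E) : R :=
  \prod_(i < n.+2) C1_step (m.+1%:R * bary V x 0 i - 1).

Lemma cutoff01 m x : 0 <= cutoff m x <= 1.
Proof.
rewrite prodr_ge0 /= => [|i _]; last by case/andP: (C1_step01 (m.+1%:R * bary V x 0 i - 1)).
by apply: prodr_ile1 => i _; exact: C1_step01.
Qed.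

Lemma C1_dir_cutoff m : C1_dir (cutoff m).
Proof.
have step (f : E -> R) : C1_dir f -> C1_dir (fun x => Num.max (1 - f x) 0 ^+ 2).
  move=> hf; apply: C1_dir_sqr_pos_part; apply: C1_dirD; first exact: C1_dir_cst.
  under eq_fun do rewrite -mulN1r.
  by apply: C1_dirM => //; exact: C1_dir_cst.
apply: C1_dir_prod => i; apply: (step); apply: (step).
apply: C1_dirD; last exact: C1_dir_cst.
by apply: C1_dirM; [exact: C1_dir_cst|exact: C1_dir_bary].
Qed.

Lemma cutoff_support m : closure [set x | cutoff m x != 0] `<=`
  [set x | forall i, m.+1%:R^-1 <= bary V x 0 i].
Proof.
have cl : closed [set x : E | forall i, m.+1%:R^-1 <= bary V x 0 i].
  have -> : [set x | forall i, m.+1%:R^-1 <= bary V x 0 i] =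
    \bigcap_(i in setT) [set x | m.+1%:R^-1 <= bary V x 0 i].
    by apply/seteqP; split => x /= h i => [_|]; exact: h.
  apply: closed_bigI => i _.
  by apply: (closed_comp _ (@closed_ge _ _)) => x _; exact: bary_continuous.
rewrite [X in _ `<=` X]((closure_id _).1 cl).
apply: closureS => x /= h i; rewrite leNgt; apply/negP => hi.
move/negP: h; apply; rewrite /cutoff (bigD1 i) //= C1_step_le0 ?mul0r //.
by rewrite subr_le0 mulrC -ler_pdivlMr // div1r ltW.
Qed.

Lemma test_fun_cutoff m : test_fun (interior (simplex V)) (cutoff m).
Proof.
have sub : closure [set x | cutoff m x != 0] `<=` osimplex V.
  move=> x /cutoff_support h i; apply: lt_le_trans (h i).
  by rewrite invr_gt0.
split.
- exact: C1_dir_C1 (C1_dir_cutoff m).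
- apply: bounded_closed_compact; last exact: closed_closure.
  have [M hM] := simplex_bounded affV; exists M; split; first exact: num_real.
  move=> r Mr x /sub /osimplex_sub_simplex -/(_ affV) sx.
  have r0 : 0 <= r.
    by apply: le_trans (ltW Mr); apply: le_trans (hM _ sx ord0).
  by apply/rV_norm_leP => // j; apply: le_trans (ltW Mr); exact: hM.
- by move=> x /sub; exact: osimplex_sub_interior.
Qed.

Lemma cutoff_cvg x : osimplex V x -> (fun m => cutoff m x) @ \oo --> (1 : R).
Proof.
move=> ox; apply: cvg_near_cst.
have h : \forall m \near \oo, forall i : 'I_n.+2, 1 <= m.+1%:R * bary V x 0 i - 1.
  apply: filter_forall => i.
  near=> m; rewrite lerBrDl -ler_pdivrMr ?ox //.
  apply: (@le_trans _ _ m%:R); last by rewrite ler_nat.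
  by near: m; exact: nbhs_infty_ger.
apply: filterS h => m h; rewrite /cutoff big1 // => i _; exact: C1_step_ge1.
Unshelve. all: by end_near. Qed.

End cutoff.

Section flux_of_solution.
Context {R : realType} {n : nat} (V : 'M[R]_(n.+2, n.+1)).
Hypothesis affV : aff_indep V.
Local Notation E := 'rV[R]_n.+1.
Let U := interior (simplex V).

Lemma measurable_interior_simplex : measurable U.
Proof. apply: open_measurable_rV; exact: open_interior. Qed.

Lemma simplex_lty : (leb n.+1 (simplex V) < +oo)%E.
Proof.
have [M hM] := simplex_bounded affV.
apply: (bounded_rV_lebesgue_lty _ hM).
apply: closed_measurable_rV; exact: closed_simplex.
Qed.

Lemma interior_simplex_lty : (leb n.+1 U < +oo)%E.
Proof.
apply: le_lt_trans simplex_lty; apply: le_measure; rewrite ?inE.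
- exact: measurable_interior_simplex.
- by apply: closed_measurable_rV; exact: closed_simplex.
- exact: interior_subset.
Qed.

Lemma Rintegral_simplex (D D' : set E) (f : E -> R) :
  osimplex V `<=` D -> osimplex V `<=` D' -> D `<=` simplex V -> D' `<=` simplex V ->
  \int[leb n.+1]_(x in D) f x = \int[leb n.+1]_(x in D') f x.
Proof.
have key A : osimplex V `<=` A -> A `<=` simplex V ->
    \int[leb n.+1]_(x in A) f x = \int[leb n.+1]_(x in osimplex V) f x.
  move=> oA As; have [mZ Z0] := bary_zeros_null affV.
  apply: (Rintegral_setD_null _ mZ Z0) => //.
  by move=> x [/As sx nz]; exact: simplex_bary_zeros.
by move=> h1 h2 h3 h4; rewrite !key.
Qed.

(** Applied to the representative chosen by [weak_div] and to [- f]. Tested with a cutoff, both give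
    the same number; dominated convergence on the open simplex, where the cutoffs tend to 1, removes
    the cutoff. *)
Lemma weak_div_integral_unique (sigma : E -> E) (g1 g2 : E -> R) :
  is_weak_div U sigma g1 -> is_weak_div U sigma g2 ->
  \int[leb n.+1]_(x in U) g1 x = \int[leb n.+1]_(x in U) g2 x.
Proof.
move=> [Lg1 h1] [Lg2 h2].
have mO : measurable (osimplex V) by apply: open_measurable_rV; exact: open_osimplex.
have oU : osimplex V `<=` U by exact: osimplex_sub_interior.
have Us : U `<=` simplex V by exact: interior_subset.
have toO f : \int[leb n.+1]_(x in U) f x = \int[leb n.+1]_(x in osimplex V) f x.
  by apply: Rintegral_simplex => //; exact: osimplex_sub_simplex.
have cv g : L2 U g ->
    (fun m => \int[leb n.+1]_(x in U) (g x * cutoff V m x)) @ \oo -->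
    \int[leb n.+1]_(x in U) g x.
  move=> Lg; rewrite toO.
  have -> : (fun m => \int[leb n.+1]_(x in U) (g x * cutoff V m x)) =
      (fun m => \int[leb n.+1]_(x in osimplex V) (g x * cutoff V m x)).
    by apply/funext => m; rewrite toO.
  apply: cvg_Rintegral_cutoff => //.
  - apply: (integrableS measurable_interior_simplex) => //.
    exact: (Lfun2_integrable_on measurable_interior_simplex interior_simplex_lty).
  - move=> m; apply: measurable_funTS; apply: continuous_measurable_rV.
    by case: (C1_dir_cutoff V m).
  - by move=> m x; exact: cutoff01.
  - by move=> x; exact: cutoff_cvg.
have e : (fun m => \int[leb n.+1]_(x in U) (g1 x * cutoff V m x)) =
         (fun m => \int[leb n.+1]_(x in U) (g2 x * cutoff V m x)).
  apply/funext => m; apply: oppr_inj.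
  by rewrite -h1 ?h2 //; exact: test_fun_cutoff.
have := cv g1 Lg1; rewrite e => c1.
by have := cvg_unique _ c1 (cv g2 Lg2); apply; exact: norm_hausdorff.
Qed.

(** A test function of the simplex is one of [Omega], and since it vanishes with its gradient
    outside [U], the integrals over [Omega] and over [U] agree. *)
Lemma is_weak_div_sub (Omega : set E) (sigma : E -> E) (g : E -> R) :
  U `<=` Omega -> is_weak_div Omega sigma g -> is_weak_div U sigma g.
Proof.
move=> UO [Lg hg]; split.
  rewrite /L2 (_ : g \_ U = (g \_ Omega) \_ U).
    by apply: Lfun2_restrict => //; exact: measurable_interior_simplex.
  apply/funext => x; rewrite /patch; case: ifPn => // /[!inE] Ux.
  by rewrite mem_set //; exact: UO.
move=> phi [c1 cpt sub].
have out x : ~ U x -> ~ closure [set x | phi x != 0] x by move=> nU /sub.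
have phi0 x : ~ U x -> phi x = 0.
  move=> /out h; apply/eqP; apply: contra_notT h => h; exact: subset_closure.
have grad0 x : ~ U x -> grad phi x = 0.
  by move=> /out h; apply/rowP => i; rewrite !mxE derive_out_of_support.
have := hg phi; rewrite (Rintegral_sub_support _ UO); last first.
  by move=> x /grad0 ->; rewrite dot0r.
rewrite (Rintegral_sub_support _ UO); last by move=> x /phi0 ->; rewrite mulr0.
by apply; split => //; exact: subset_trans UO.
Qed.

Lemma normal_flux_simplex (Omega : set E) (sigma : E -> E) (f : E -> R) :
  U `<=` Omega -> L2 Omega f -> is_weak_div Omega sigma (fun x => - f x) ->
  normal_flux U sigma = - \int[leb n.+1]_(x in simplex V) f x.
Proof.
move=> UO Lf hs; have hU := is_weak_div_sub UO hs.
have hw : is_weak_div U sigma (weak_div U sigma).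
  by apply: (@xgetPex _ (cst 0) [set g | is_weak_div U sigma g]); exists (fun x => - f x).
rewrite /normal_flux /normal_trace.
under eq_Rintegral => x _.
  have -> : grad (cst 1 : E -> R) x = 0.
    by apply/rowP => i; rewrite !mxE derive_cst.
  rewrite dot0r add0r /= mulr1; over.
rewrite (weak_div_integral_unique hw hU).
have mU := measurable_interior_simplex.
have iF : (leb n.+1).-integrable U (EFin \o (fun x => - f x)).
  by apply: (Lfun2_integrable_on mU interior_simplex_lty); exact: hU.1.
rewrite (@Rintegral_simplex (simplex V) U f) //; first last.
- exact: interior_subset.
- exact: osimplex_sub_interior.
- exact: osimplex_sub_simplex.
rewrite -mulN1r -RintegralZl //; last first.
  have := integrableN iF; apply: eq_integrable => // x _ /=.
  by rewrite opprK.
by apply: eq_Rintegral => x _; rewrite mulN1r.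
Qed.

End flux_of_solution.

(** * Inner traces along normal rays *)

Section rays.
Context {R : realType} {d : nat}.
Local Notation E := 'rV[R]_d.
Implicit Types (y nu : E).

Lemma ray_cvg y nu : (fun s : R => y - s *: nu) @ (0 : R)^'+ --> y.
Proof.
apply: cvg_at_right_filter.
rewrite -[X in _ --> X]subr0 -[X in _ - X](scale0r nu).
apply: cvgB; first exact: cvg_cst.
by apply: cvgZr_tmp; exact: cvg_id.
Qed.

Lemma right_quotient_cvg (p : E -> R) y nu : C1_dir p ->
  (fun s => (p y - p (y - s *: nu)) / s) @ (0 : R)^'+ --> - 'D_(- nu) p y.
Proof.
move=> hp.
have h : (fun h : R => h^-1 *: ((p \o shift y) (h *: - nu) - p y)) @ 0^' --> 'D_(- nu) p y.
  exact: (hp.2 (- nu)).1.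
have -> : (fun s => (p y - p (y - s *: nu)) / s) =
    (fun s => - (s^-1 *: ((p \o shift y) (s *: - nu) - p y))).
  apply/funext => s /=; rewrite scalerN [_ + y]addrC /GRing.scale /=.
  by rewrite -mulrN opprB mulrC.
by apply: cvgN; exact: cvg_dnbhs_at_right.
Qed.

Lemma C1_ray_neq0 (p : E -> R) y nu : C1_dir p -> (p y = 0 -> 'D_(- nu) p y != 0) ->
  \forall s \near (0 : R)^'+, p (y - s *: nu) != 0.
Proof.
move=> hp; have [py0|py _] := eqVneq (p y) 0.
  move=> /(_ py0) D0.
  have h := right_quotient_cvg (y := y) (nu := nu) hp.
  have : \forall s \near (0 : R)^'+, (p y - p (y - s *: nu)) / s != 0.
    apply: (h [set z | z != 0]); apply: open_nbhs_nbhs; split; first exact: open_neq.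
    by rewrite /= oppr_eq0.
  by apply: filterS => s; apply: contra_neq => ->; rewrite py0 subrr mul0r.
have h : (fun s : R => p (y - s *: nu)) @ (0 : R)^'+ --> p y.
  apply: (@cvg_comp _ _ _ (fun s : R => y - s *: nu) p _ (nbhs y)); first exact: ray_cvg.
  exact: hp.1.
by apply: (h [set z | z != 0]); apply: open_nbhs_nbhs; split; first exact: open_neq.
Qed.

Lemma near0_right (P : R -> Prop) : (\forall s \near (0 : R)^'+, P s) ->
  exists2 e : R, 0 < e & forall s, 0 < s < e -> P s.
Proof.
move=> /nbhs_ballP[e /= e0 he]; exists e => // s /andP[s0 se].
by apply: he => //; rewrite /ball /= sub0r normrN gtr0_norm.
Qed.

(** An initial open segment of the ray is connected and covered by disjoint open pieces, so it lies
    in the piece that contains its midpoint. Without this the ray could change pieces infinitely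
    often and [alpha] have no limit along it. *)
Lemma ray_in_one_piece (p : nat) (P : 'I_p -> set E) y nu :
  (forall j, open (P j)) -> (forall i j, i != j -> P i `&` P j = set0) ->
  (\forall s \near (0 : R)^'+, (\bigcup_j P j) (y - s *: nu)) ->
  exists j, \forall s \near (0 : R)^'+, P j (y - s *: nu).
Proof.
move=> oP dP /near0_right[e e0 he].
pose F (s : R) := y - s *: nu.
have cF : continuous F.
  move=> s; apply: cvgB; first exact: cvg_cst.
  by apply: cvgZr_tmp; exact: cvg_id.
have e2 : 0 < e / 2 < e by apply/andP; split; lra.
have [j _ Pj] := he _ e2.
exists j.
pose A : set R := [set` `]0, e[].
have AE s : A s = (0 < s < e) by rewrite /A /= in_itv.
have : A `&` (F @^-1` P j) = A.
  have /connected_intervalP cA : is_interval A by exact: interval_is_interval.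
  apply: cA.
  - by exists (e / 2); split => //; rewrite AE.
  - by exists (F @^-1` P j) => //; apply: open_comp => // x _; exact: cF.
  (* On the segment, lying in [P j] amounts to avoiding all other pieces, which is a closed
     condition. *)
  exists (~` (F @^-1` \bigcup_(i in [set i | i != j]) P i)).
    apply: open_closedC; apply: open_comp; first by move=> x _; exact: cF.
    by apply: bigcup_open => i _; exact: oP.
  apply/seteqP; split => s [As].
    move=> Pjs; split => // -[i /= ij Pis].
    by have := dP _ _ ij; rewrite -subset0 => /(_ (F s)); apply.
  move=> nP; split => //; rewrite AE in As; have [i _ Pi] := he _ As.
  by have [<- //|ij] := eqVneq i j; case: nP; exists i.
move=> AP; near=> s.
have : A s.
  rewrite AE; apply/andP; split; first by near: s; exact: nbhs_right_gt.
  by near: s; exact: nbhs_right_lt.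
by rewrite -AP => -[].
Unshelve. all: by end_near. Qed.

End rays.

Section piecewise.
Context {R : realType} {d : nat}.
Local Notation E := 'rV[R]_d.
Variables (Omega : set E) (alpha : E -> R) (P : set E) (beta : E -> R).
Hypotheses (oP : open P) (PO : P `<=` Omega).
Hypothesis cb : {within closure P, continuous beta}.
Hypothesis ab : {in P, alpha =1 beta}.

Lemma piece_continuous x : P x -> {for x, continuous alpha}.
Proof.
move=> Px.
have : {within P, continuous beta} by apply: continuous_subspaceW cb; exact: subset_closure.
rewrite continuous_open_subspace // => /(_ x (mem_set Px)) cx.
have e : \forall z \near nbhs x, beta z = alpha z.
  have : nbhs x P by exact: open_nbhs_nbhs.
  by apply: filterS => z Pz; rewrite ab // inE.
have ax : alpha x = beta x by rewrite ab // inE.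
suff : alpha @ nbhs x --> alpha x by [].
by rewrite ax; apply: cvg_trans cx; apply: near_eq_cvg.
Qed.

(** If the bound failed at a point of the piece, continuity would make it fail on a nonempty open
    set, which has positive measure. *)
Lemma piece_ge (c : R) : {ae leb d, forall x, Omega x -> c <= alpha x} ->
  forall x, P x -> c <= alpha x.
Proof.
move=> [N [mN N0 hN]] x Px; rewrite leNgt; apply/negP => ax.
have nx : nbhs x (P `&` [set z | alpha z < c]).
  apply: filterI; first exact: open_nbhs_nbhs.
  have na : nbhs (alpha x) [set r | r < c].
    by apply: open_nbhs_nbhs; split => //; exact: open_lt.
  exact: (piece_continuous Px na).
have oI : open (P `&` [set z | alpha z < c])° by exact: open_interior.
have := open_rV_lebesgue_gt0 oI (ex_intro _ x nx).
apply/negP; rewrite -leNgt -[X in (_ <= X)%E]N0.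
apply: le_measure; rewrite ?inE //; first exact: open_measurable_rV.
move=> z /interior_subset [Pz az]; apply: hN => /= h.
by have := h (PO Pz); rewrite leNgt az.
Qed.

Lemma piece_trace (y nu : E) : (\forall s \near (0 : R)^'+, P (y - s *: nu)) ->
  alpha (y - s *: nu) @[s --> (0 : R)^'+] --> beta y.
Proof.
move=> h.
have cy : closure P y.
  move=> B By.
  have hB : \forall s \near (0 : R)^'+, B (y - s *: nu) by exact: ray_cvg.
  have [s [Ps Bs]] := filter_ex (filterI h hB).
  by exists (y - s *: nu).
have hb : beta (y - s *: nu) @[s --> (0 : R)^'+] --> beta y.
  apply: (@cvg_comp _ _ _ (fun s : R => y - s *: nu) beta _ (within (closure P) (nbhs y))).
    move=> B /= HB.
    have hB : \forall s \near (0 : R)^'+, closure P (y - s *: nu) -> B (y - s *: nu).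
      exact: (@ray_cvg R d y nu [set z | closure P z -> B z]).
    apply: filterS (filterI h hB) => s [Ps]; apply; exact: subset_closure.
  by rewrite nbhs_subspace_in //; exact: cb.
apply: cvg_trans hb; apply: near_eq_cvg; apply: filterS h => s Ps.
by rewrite ab // inE.
Qed.

End piecewise.

(** * Fluxes through the faces *)

Section cube.
Context {R : realType} {d : nat}.

Lemma continuous_bounded_cube (f : 'rV[R]_d -> R) (M : R) : continuous f ->
  exists C : R, forall t : 'rV[R]_d, (forall i, `|t 0 i| <= M) -> `|f t| <= C.
Proof.
move=> cf.
have cK : compact [set t : 'rV[R]_d | forall i, t 0 i \in `[(- M), M]].
  by apply: (@rV_compact _ _ (fun=> [set` `[(- M), M]])) => i; exact: segment_compact.
have /compact_bounded[C [_ hC]] : compact (f @` [set t : 'rV[R]_d | forall i, t 0 i \in `[(- M), M]]).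
  by apply: continuous_compact => //; exact: continuous_subspaceT.
exists (C + 1) => t ht; apply: hC; first by rewrite ltrDl.
by exists t => // i; rewrite in_itv /= -ler_norml.
Qed.

Lemma sum_coord_continuous : continuous (fun t : 'rV[R]_d => \sum_j t 0 j).
Proof.
by apply: cvg_continuous_rV => t; apply: cvg_sumr => j; exact: coord_continuous.
Qed.

End cube.

Section reference_simplex.
Context {R : realType} {n : nat}.
Local Notation E := 'rV[R]_n.

Definition ref_simplex : set E := [set t | (forall j, 0 <= t 0 j) /\ \sum_j t 0 j <= 1].
Definition oref_simplex : set E := [set t | (forall j, 0 < t 0 j) /\ \sum_j t 0 j < 1].

Lemma oref_sub_ref : oref_simplex `<=` ref_simplex.
Proof. by move=> t [h1 h2]; split => [j|]; exact: ltW. Qed.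

Lemma open_oref_simplex : open oref_simplex.
Proof.
rewrite openE => t [h1 h2]; apply: filterI.
  apply: (@filter_forall _ _ _ (nbhs t)) => j.
  apply: (@coord_continuous R 1 n 0 j t [set y | 0 < y]).
  by apply: open_nbhs_nbhs; split; [exact: (@open_gt _ 0)|exact: h1].
apply: (@sum_coord_continuous R n t [set y | y < 1]).
by apply: open_nbhs_nbhs; split; [exact: open_lt|exact: h2].
Qed.

Lemma oref_simplex_neq0 : oref_simplex !=set0.
Proof.
exists (const_mx n.+1%:R^-1); split => [j|]; first by rewrite mxE invr_gt0.
under eq_bigr do rewrite mxE.
rewrite sumr_const card_ord -[X in X < _]mulr_natl ltr_pdivrMr // mul1r ltr_nat.
exact: ltnSn.
Qed.

Lemma ref_simplex_bound t : ref_simplex t -> forall i, `|t 0 i| <= 1.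
Proof.
move=> [h1 h2] i; rewrite ger0_norm //; apply: le_trans h2.
by rewrite (bigD1 i) //= lerDl sumr_ge0.
Qed.

Lemma ref_simplex_boundary_null : (0 < n)%N -> exists N : set E,
  [/\ measurable N, leb n N = 0%E & ref_simplex `\` N `<=` oref_simplex].
Proof.
(* [j0] gives a direction in which the sum of the coordinates varies, so that its level set 1 is
   null. *)
move=> n0; pose j0 := Ordinal n0.
pose Z (j : 'I_n) : set E := [set t | t 0 j = 0].
have hZ j : measurable (Z j) /\ leb n (Z j) = 0%E.
  apply: (@affine_zero_null _ _ (fun t => t 0 j) (fun v => v 0 j) (delta_mx 0 j)).
  - exact: coord_continuous.
  - by move=> y v h; rewrite !mxE.
  - by rewrite mxE !eqxx oner_eq0.
pose Z1 : set E := [set t | \sum_j t 0 j - 1 = 0].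
have hZ1 : measurable Z1 /\ leb n Z1 = 0%E.
  apply: (@affine_zero_null _ _ (fun t => \sum_j t 0 j - 1) (fun v => \sum_j v 0 j) (delta_mx 0 j0)).
  - apply: cvg_continuous_rV => x; apply: cvgB; last exact: cvg_cst.
    exact: sum_coord_continuous.
  - move=> y v h; rewrite addrAC; congr (_ - _).
    by rewrite mulr_sumr -big_split; apply: eq_bigr => i _; rewrite !mxE.
  - rewrite (bigD1 j0) //= mxE !eqxx big1 ?addr0 ?oner_eq0 // => i ij.
    by rewrite mxE (negbTE ij) andbF.
exists (\big[setU/set0]_(j < n) Z j `|` Z1); split.
- apply: measurableU; last exact: hZ1.1.
  by apply: bigsetU_measurable => j _; exact: (hZ j).1.
- have [mZ1 Z10] := hZ1; rewrite measureU0.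
  + by apply: measure_fin_bigsetU0 => j; [exact: (hZ j).1|exact: (hZ j).2].
  + by apply: bigsetU_measurable => j _; exact: (hZ j).1.
  + exact: mZ1.
  + exact: Z10.
move=> t [[h1 h2] nN]; split => [j|].
  rewrite lt_def h1 andbT; apply/eqP => tj; apply: nN; left.
  by rewrite -bigcup_seq; exists j => //=; rewrite mem_index_enum.
by rewrite lt_def h2 andbT eq_sym; apply/eqP => e; apply: nN; right; rewrite /Z1 /= e subrr.
Qed.

End reference_simplex.

Section face.
Context {R : realType} {n : nat} (V : 'M[R]_(n.+2, n.+1)) (i : 'I_n.+2).
Hypothesis affV : aff_indep V.
Local Notation E := 'rV[R]_n.+1.
Local Notation nu := (outward_normal V i).

Definition face_map (t : 'rV[R]_n) : E := row ord0 (row' i V) + t *m edges (row' i V).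

Lemma face_map_affine x w (h : R) :
  face_map (x + h *: w) = face_map x + h *: (w *m edges (row' i V)).
Proof. by rewrite /face_map mulmxDl scalemxAl addrA. Qed.

Lemma face_map_continuous : continuous face_map.
Proof.
suff h t : face_map @ nbhs t --> face_map t by move=> t; exact: h.
apply/cvg_ballP => e e0.
have hj j : \forall s \near nbhs t, ball (face_map t 0 j) e (face_map s 0 j).
  suff /(_ t) : continuous (fun s : 'rV[R]_n => face_map s 0 j) by move=> /cvg_ballP; exact.
  have -> : (fun s : 'rV[R]_n => face_map s 0 j) =
      (fun s => row ord0 (row' i V) 0 j + \sum_k s 0 k * edges (row' i V) k j).
    by apply/funext => s; rewrite !mxE.
  apply: cvg_continuous_rV => x; apply: cvgD; first exact: cvg_cst.
  by apply: cvg_sumr => k; apply: cvgMr_tmp; exact: coord_continuous.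
have hs : \forall s \near nbhs t, forall j, ball (face_map t 0 j) e (face_map s 0 j).
  by apply: filter_forall => j; exact: hj.
apply: filterS hs => s hs; split => // i' j; rewrite ord1; exact: hs.
Qed.

Lemma face_map_bary t : [/\ bary V (face_map t) 0 i = 0,
  ref_simplex t -> simplex V (face_map t) &
  oref_simplex t -> forall a, a != i -> 0 < bary V (face_map t) 0 a].
Proof.
have [h1 h2 h3] := face_point_bary affV i t; rewrite -/(face_map t) in h1 h2 h3.
split => //.
  rewrite simplexE // => -[t0 t1] a; case: (unliftP i a) => [c ->|->]; last by rewrite h1.
  by case: (unliftP ord0 c) => [j ->|->]; rewrite ?h2 ?h3 // subr_ge0.
move=> [t0 t1] a; rewrite eq_sym => /unlift_some[c -> _].
by case: (unliftP ord0 c) => [j ->|->]; rewrite ?h2 ?h3 // subr_gt0.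
Qed.

Lemma face_ray t : oref_simplex t ->
  \forall s \near (0 : R)^'+, osimplex V (face_map t - s *: nu).
Proof.
move=> ot; have [b0 _ /(_ ot) bp] := face_map_bary t.
apply: filter_forall => a; have [->|ai] := eqVneq a i.
  near=> s; have s0 : 0 < s by near: s; exact: nbhs_right_gt.
  rewrite -scaleNr baryD mxE b0 add0r mxE.
  by rewrite mulNr oppr_gt0 pmulr_rlt0 // (bary_lin_normal_lt0 affV) //; exact: outward_normalP.
have h : (fun s : R => bary V (face_map t - s *: nu) 0 a) @ (0 : R)^'+ --> bary V (face_map t) 0 a.
  apply: (@cvg_comp _ _ _ (fun s : R => face_map t - s *: nu) (fun x => bary V x 0 a) _ (nbhs (face_map t))).
    exact: ray_cvg.
  exact: bary_continuous.
apply: (h [set z | 0 < z]); apply: open_nbhs_nbhs; split; first exact: open_gt.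
exact: bp.
Unshelve. all: by end_near. Qed.

Lemma inner_nderiv_face (v p : E -> R) t : C1_dir p -> {in simplex V, v =1 p} ->
  oref_simplex t -> inner_nderiv nu v (face_map t) = - 'D_(- nu) p (face_map t).
Proof.
move=> hp vp ot; have [_ /(_ (oref_sub_ref ot)) st _] := face_map_bary t.
apply: cvg_lim; first exact: norm_hausdorff.
have h := right_quotient_cvg (y := face_map t) (nu := nu) hp.
apply: cvg_trans h; apply: near_eq_cvg; apply: filterS (face_ray ot) => s os.
by rewrite !vp // inE //; exact: osimplex_sub_simplex.
Qed.

Definition bubble_poly (x : E) : R := n.+2%:R ^+ n.+2 * \prod_j bary V x 0 j.

Lemma bubble_simplex : {in simplex V, bubble V =1 bubble_poly}.
Proof. by move=> x xV; rewrite /bubble /patch xV. Qed.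

Lemma C1_dir_bubble_poly : C1_dir bubble_poly.
Proof.
apply: C1_dirM; first exact: C1_dir_cst.
by apply: C1_dir_prod => j; exact: C1_dir_bary.
Qed.

(** On the open face only the [i]-th factor vanishes, so the product rule leaves its derivative
    along the inward direction [- nu] times the other, positive, factors. *)
Lemma bubble_poly_derive_gt0 t : oref_simplex t ->
  0 < 'D_(- nu) bubble_poly (face_map t).
Proof.
move=> ot; have [b0 _ /(_ ot) bp] := face_map_bary t.
pose rest (x : E) : R := \prod_(j < n.+2 | j != i) bary V x 0 j.
have hr : C1_dir rest by apply: C1_dir_prod => j; exact: C1_dir_bary.
pose l (x : E) : R := bary V x 0 i.
have dl := C1_dir_is_derive (- nu) (face_map t) (C1_dir_bary V i : C1_dir l).
have dr := C1_dir_is_derive (- nu) (face_map t) hr.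
have [c [c0 ->]] : exists c : R, 0 < c /\ bubble_poly = c \*: (l * rest).
  exists (n.+2%:R ^+ n.+2); split; first by rewrite exprn_gt0 ?ltr0n.
  by apply/funext => x; rewrite /bubble_poly (bigD1 i).
have := is_deriveZ c (is_deriveM dl dr); case=> _ ->.
rewrite {1}/l b0 scale0r add0r derive_bary bary_linN mxE /GRing.scale /=.
rewrite !mulr_gt0 //; first by apply: prodr_gt0 => j; exact: bp.
by rewrite oppr_gt0 (bary_lin_normal_lt0 affV) //; exact: outward_normalP.
Qed.

(** This covers a hypersurface that contains part of the face: there the tangential gradient
    vanishes, hence the normal derivative cannot, and the ray leaves the hypersurface at once. *)
Lemma face_hypersurface_avoided (psi : E -> R) t : C1 psi ->
  (forall x, psi x = 0 -> grad psi x != 0) ->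
  ~ (psi (face_map t) = 0 /\ grad (psi \o face_map) t != 0) ->
  \forall s \near (0 : R)^'+, psi (face_map t - s *: nu) != 0.
Proof.
move=> c1 hpsi ht; have cd := C1_C1_dir c1.
apply: C1_ray_neq0 => // p0; apply/eqP; rewrite C1_grad // => D0.
have hnu := outward_normalP affV i.
have /eqP := hpsi _ p0; apply; apply: (face_normal_span affV hnu).
  apply: face_orthogonal_edges => j.
  have [_ hD] := C1_dir_comp_affine face_map_continuous face_map_affine cd.
  rewrite rowE -C1_grad // -hD.
  have -> : 'D_(delta_mx 0 j) (psi \o face_map) t = grad (psi \o face_map) t 0 j.
    by rewrite mxE.
  have [->|g0] := eqVneq (grad (psi \o face_map) t) 0; first by rewrite mxE.
  by case: ht.
by move/eqP: D0; rewrite -scaleN1r dotZr mulN1r oppr_eq0 => /eqP.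
Qed.

Lemma natSinv_cvg_right : (fun m : nat => m.+1%:R^-1 : R) @ \oo --> (0 : R)^'+.
Proof.
move=> P /near0_right[e e0 he].
have := near_infty_natSinv_lt (PosNum e0); apply: filterS => m /= hm.
by apply: he; rewrite hm andbT invr_gt0.
Qed.

Lemma face_trace (Omega : set E) (alpha : E -> R) (alpha0 M : R) : (0 < n)%N ->
  osimplex V `<=` Omega -> (forall x, Omega x -> `|alpha x| <= M) ->
  piecewise_continuous Omega alpha ->
  {ae leb n.+1, forall x, Omega x -> alpha0 <= alpha x} ->
  exists G : set 'rV[R]_n,
    [/\ measurable G, (0 < leb n G)%E, G `<=` oref_simplex,
        forall g : 'rV[R]_n -> R, \int[leb n]_(t in ref_simplex) g t = \int[leb n]_(t in G) g t &
        measurable_fun G (fun t => inner_trace nu alpha (face_map t)) /\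
        forall t, G t -> alpha0 <= inner_trace nu alpha (face_map t) <= M].
Proof.
move=> n0 VO aM [p [s [P [psi [hP dP hpsi cov hb]]]]] a0.
have oP j : open (P j) by exact: (hP j).1.
have PO j : P j `<=` Omega by exact: (hP j).2.
pose W := \bigcup_j P j.
have oW : open W by apply: bigcup_open => j _.
pose Z l := [set t | (psi l \o face_map) t = 0 /\ grad (psi l \o face_map) t != 0].
have hZ l : measurable (Z l) /\ leb n (Z l) = 0%E.
  apply: C1_zero_set; apply: C1_dir_C1.
  apply: (C1_dir_comp_affine face_map_continuous face_map_affine _).1.
  by apply: C1_C1_dir; exact: (hpsi l).1.
pose N := \big[setU/set0]_(l < s) Z l.
have mN : measurable N by apply: bigsetU_measurable => l _; exact: (hZ l).1.
have N0 : leb n N = 0%E.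
  by apply: measure_fin_bigsetU0 => l; [exact: (hZ l).1|exact: (hZ l).2].
have mO : measurable (@oref_simplex R n) by apply: open_measurable_rV; exact: open_oref_simplex.
pose G := @oref_simplex R n `\` N.
have mG : measurable G by exact: measurableD.
have nZ t l : G t -> ~ Z l t.
  move=> [_ nN] zl; apply: nN; rewrite /N -bigcup_seq; exists l => //=.
  by rewrite mem_index_enum.
have key t : G t -> exists2 a, alpha0 <= a <= M &
    alpha (face_map t - r *: nu) @[r --> (0 : R)^'+] --> a /\
    \forall r \near (0 : R)^'+, W (face_map t - r *: nu).
  move=> Gt; have ot : oref_simplex t by case: Gt.
  have hW : \forall r \near (0 : R)^'+, W (face_map t - r *: nu).
    have hs : \forall r \near (0 : R)^'+, forall l, psi l (face_map t - r *: nu) != 0.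
      apply: filter_forall => l; apply: face_hypersurface_avoided.
      - exact: (hpsi l).1.
      - exact: (hpsi l).2.
      - exact: nZ.
    apply: filterS (filterI hs (face_ray ot)) => r [hs' /VO os].
    apply: contrapT => nW; have /cov[l _ /eqP] : (Omega `\` W) (face_map t - r *: nu) by [].
    by apply/negP; exact: hs'.
  have [j hj] := ray_in_one_piece oP dP hW.
  have [beta [cb ab]] := hb j.
  have cv := piece_trace cb ab hj.
  exists (beta (face_map t)) => //.
  (* The bounds hold at every point of the ray near the face and pass to the limit because the
     interval is closed. *)
  apply: (closed_cvg (fun z : R => is_true (alpha0 <= z <= M)) _ _ _ cv).
    have -> : (fun z : R => is_true (alpha0 <= z <= M)) = [set` `[alpha0, M]].
      by apply/funext => z; rewrite /= in_itv.
    exact: interval_closed.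
  apply: filterS hj => r Pr; apply/andP; split.
    exact: (piece_ge (oP j) (PO j) cb ab a0).
  by apply: le_trans (ler_norm _) _; apply: aM; exact: (PO j).
have trE t a : alpha (face_map t - r *: nu) @[r --> (0 : R)^'+] --> a ->
    inner_trace nu alpha (face_map t) = a.
  by move=> h; apply: cvg_lim => //; exact: norm_hausdorff.
exists G; split => //.
- apply: lt_le_trans (open_rV_lebesgue_gt0 (@open_oref_simplex R n) (@oref_simplex_neq0 R n)) _.
  rewrite -(measureU0 mG mN N0); apply: le_measure; rewrite ?inE //.
    exact: measurableU.
  by move=> t ot; have [Nt|nNt] := pselect (N t); [right|left].
- by move=> t [].
- move=> g; have [B [mB B0 hB]] := @ref_simplex_boundary_null R n n0.
  apply: (@Rintegral_setD_null _ _ _ (leb n) _ (B `|` N)).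
  + exact: measurableU.
  + by rewrite measureU0.
  + move=> t [rt nBN]; split; last by move=> Nt; apply: nBN; right.
    by apply: hB; split => // Bt; apply: nBN; left.
  + by move=> t [/oref_sub_ref].
split; last first.
  by move=> t /key[a ha [h _]]; rewrite (trE _ _ h).
(* Off the pieces [alpha] is arbitrary, so it is replaced by 0 there. The result is Borel and can be
   composed with the rays; near the face these lie in [W], so the trace is the pointwise limit of
   the compositions at the distances 1/(m+1). *)
have ma : measurable_fun setT (alpha \_ W).
  apply/(measurable_restrictT _ (open_measurable_rV oW)).
  apply: continuous_on_open_measurable => // x [j _ Pj].
  have [beta [cb ab]] := hb j.
  exact: (piece_continuous (oP j) cb ab Pj).
apply: (@measurable_fun_cvg _ _ _ G (fun (m : nat) t => (alpha \_ W) (face_map t - m.+1%:R^-1 *: nu))).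
  move=> m; apply: measurable_funTS; apply: (measurableT_comp ma).
  pose F (t : 'rV[R]_n) := face_map t - m.+1%:R^-1 *: nu.
  apply: (@continuous_measurable_rV_rV R n n.+1 F).
  suff cF (t : 'rV[R]_n) : F @ nbhs t --> F t by move=> t; exact: cF.
  by apply: cvgB; [exact: face_map_continuous|exact: cvg_cst].
move=> t /key[a ha [h hW]]; rewrite (trE _ _ h).
apply: (@cvg_comp _ _ _ (fun m : nat => m.+1%:R^-1 : R)
  (fun r => (alpha \_ W) (face_map t - r *: nu)) _ ((0 : R)^'+)).
  exact: natSinv_cvg_right.
apply: cvg_trans h; apply: near_eq_cvg; apply: filterS hW => r Wr.
by rewrite patchE mem_set.
Qed.

End face.

Lemma Rintegral_gt0 d (T : measurableType d) (R : realType)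
    (mu : {measure set T -> \bar R}) (D : set T) (f : T -> R) :
  measurable D -> mu.-integrable D (EFin \o f) -> (0 < mu D)%E ->
  (forall x, D x -> 0 < f x) -> 0 < \int[mu]_(x in D) f x.
Proof.
move=> mD fi D0 f0.
rewrite lt_def Rintegral_ge0 ?andbT; last by move=> x Dx; exact/ltW/f0.
apply/eqP => i0.
have /integrableP[mf _] := fi.
have : (\int[mu]_(x in D) `|(EFin \o f) x| = 0)%E.
  rewrite -[RHS](_ : (\int[mu]_(x in D) f x)%:E = 0%E); last by rewrite i0.
  rewrite /Rintegral fineK; last exact: integrable_fin_num.
  by apply: eq_integral => x /[!inE] Dx /=; rewrite gtr0_norm // f0.
move=> /(ae_eq_integral_abs mu mD mf)[N [mN N0 hN]].
move: D0; apply/negP; rewrite -leNgt -[X in (_ <= X)%E]N0.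
apply: le_measure; rewrite ?inE // => x Dx; apply: hN => /= h.
by have [] := h Dx; have /lt0r_neq0/eqP := f0 x Dx.
Qed.

(** * Linearity of the boundary flux and sign of the bubble flux *)

Section face_flux.
Context {R : realType} {n : nat} (V : 'M[R]_(n.+2, n.+1)).
Hypothesis affV : aff_indep V.
Local Notation E := 'rV[R]_n.+1.
Variables (Omega : set E) (alpha : E -> R) (alpha0 M : R).
Hypotheses (n0 : (0 < n)%N) (VO : osimplex V `<=` Omega)
  (aM : forall x, Omega x -> `|alpha x| <= M) (apc : piecewise_continuous Omega alpha)
  (a0 : 0 < alpha0) (aa0 : {ae leb n.+1, forall x, Omega x -> alpha0 <= alpha x}).

(** [Phi] takes the C^1 function [p] that represents [v] on the simplex. For such functions the
    normal derivative is a genuine, continuous directional derivative, so on [G] the integrand is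
    integrable and linear in [p]. *)
Lemma face_flux (i : 'I_n.+2) : exists Phi : (E -> R) -> R,
  [/\ forall v p, C1_dir p -> {in simplex V, v =1 p} ->
        surface_int (row' i V) (fun y => inner_trace (outward_normal V i) alpha y *
          inner_nderiv (outward_normal V i) v y) = Phi p,
      forall (c : R) p q, C1_dir p -> C1_dir q ->
        Phi (fun x => p x + c * q x) = Phi p + c * Phi q &
      Phi (bubble_poly V) < 0].
Proof.
have [G [mG G0 GO intG [mtr trb]]] := face_trace i affV n0 VO aM apc aa0.
pose nu := outward_normal V i.
pose tr t := inner_trace nu alpha (face_map V i t).
pose D p (t : 'rV[R]_n) : R := - 'D_(- nu) p (face_map V i t).
pose sq := Num.sqrt (\det (edges (row' i V) *m (edges (row' i V))^T)).
have cD p : C1_dir p -> continuous (D p).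
  move=> hp; apply: cvg_continuous_rV => t; apply: cvgN.
  apply: (@cvg_comp _ _ _ (face_map V i) (fun y => 'D_(- nu) p y) _ (nbhs (face_map V i t))).
    exact: face_map_continuous.
  exact: (hp.2 _).2.
have Gfin : (leb n G < +oo)%E.
  apply: (bounded_rV_lebesgue_lty (M := 1)) => // t /GO /oref_sub_ref.
  exact: ref_simplex_bound.
have int p : C1_dir p -> (leb n).-integrable G (EFin \o (fun t => tr t * D p t)).
  move=> hp; apply: measurable_bounded_integrable => //.
    apply: measurable_funM; first exact: mtr.
    by apply: measurable_funTS; apply: continuous_measurable_rV; exact: cD.
  (* The reference simplex lies in the cube of half-side 1, on which [D p] is bounded; the trace is
     bounded by [M]. *)
  have [C hC] := continuous_bounded_cube 1 (cD p hp).
  exists (M * C); split; first exact: num_real.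
  move=> r Cr t Gt; apply: le_trans (ltW Cr); rewrite normrM ler_pM //.
    have /andP[h1 h2] := trb t Gt; rewrite ger0_norm //.
    by apply: le_trans h1; exact: ltW.
  by apply: hC; apply: ref_simplex_bound; apply: oref_sub_ref; exact: GO.
exists (fun p => sq * \int[leb n]_(t in G) (tr t * D p t)); split.
- move=> v p hp vp; rewrite /surface_int; congr (_ * _).
  rewrite -[LHS]/(\int[leb n]_(t in ref_simplex) (tr t * inner_nderiv nu v (face_map V i t))).
  rewrite intG; apply: eq_Rintegral => t /[!inE] Gt.
  by rewrite /D (@inner_nderiv_face _ _ V i affV v p t hp vp) //; exact: GO.
- move=> c p q hp hq.
  have DD t : D (fun x => p x + c * q x) t = D p t + c * D q t.
    have dp := C1_dir_is_derive (- nu) (face_map V i t) hp.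
    have dq := C1_dir_is_derive (- nu) (face_map V i t) hq.
    have [_ e] := is_deriveD dp (is_deriveZ c dq).
    rewrite /D -[X in - X = _]/('D_(- nu) (p + c \*: q) (face_map V i t)) e.
    by rewrite opprD /GRing.scale /= mulrN.
  under eq_Rintegral do rewrite DD mulrDr mulrCA.
  rewrite RintegralD //; [|exact: int|].
    by rewrite RintegralZl //; [rewrite mulrDr mulrCA|exact: int].
  have := integrableZl mG c (int q hq); apply: eq_integrable => //.
(* The surface element is positive, and on [G], of positive measure, the integrand is strictly
   negative: a trace at least [alpha0] times minus an inward derivative that is positive. *)
- rewrite pmulr_rlt0; last by rewrite sqrtr_gt0 det_gram_gt0 // row_free_edges.
  have ib := int _ (C1_dir_bubble_poly V).
  rewrite -oppr_gt0 -mulN1r -RintegralZl //; apply: Rintegral_gt0 => //.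
    have := integrableZl mG (-1) ib; apply: eq_integrable => //.
  move=> t Gt; rewrite mulN1r /D mulrN opprK mulr_gt0 //.
    by have /andP[h1 _] := trb t Gt; apply: lt_le_trans h1.
  by apply: bubble_poly_derive_gt0 => //; exact: GO.
Qed.

Lemma bnd_flux_corrected (v w p : E -> R) (c : R) : C1_dir p ->
  {in simplex V, v =1 p} -> {in simplex V, w =1 fun x => p x + c * bubble_poly V x} ->
  bnd_flux alpha V w = bnd_flux alpha V v + c * bnd_flux alpha V (bubble V) /\
  bnd_flux alpha V (bubble V) < 0.
Proof.
move=> hp vp wp; have [Phi hPhi] := choice face_flux.
have hb := C1_dir_bubble_poly V.
have hpb : C1_dir (fun x => p x + c * bubble_poly V x).
  by apply: C1_dirD => //; apply: C1_dirM => //; exact: C1_dir_cst.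
have e g q : C1_dir q -> {in simplex V, g =1 q} -> bnd_flux alpha V g = \sum_i Phi i q.
  by move=> hq gq; apply: eq_bigr => i _; have [h _ _] := hPhi i; exact: h.
rewrite (e w _ hpb wp) (e v _ hp vp) (e _ _ hb (@bubble_simplex _ _ V)); split.
  rewrite mulr_sumr -big_split; apply: eq_bigr => i _.
  by have [_ h _] := hPhi i; exact: h.
rewrite -oppr_gt0 -sumrN big_ord_recl ltr_pwDl //.
  by rewrite oppr_gt0; have [] := hPhi ord0.
by apply: sumr_ge0 => i _; rewrite oppr_ge0; apply: ltW; have [] := hPhi (lift ord0 i).
Qed.

End face_flux.

(** On its own boundary the bubble has a zero factor. A point of [simplex (T i)] in the open simplex
    of [T j] is impossible: moved slightly towards an inner point [c] of [T i], it would lie in both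
    interiors, which are disjoint. *)
Lemma bubble_other_simplex (R : realType) d (Omega : set 'rV[R]_d) N
    (T : 'I_N -> 'M[R]_(d.+1, d)) (i j : 'I_N) x :
  triangulation Omega T -> j != i -> simplex (T i) x -> bubble (T j) x = 0.
Proof.
move=> [aff _ _ disj _] ji xi; rewrite /bubble /patch.
case: ifPn => // /[!inE] xj.
have [xk|nz] := boolP [exists k, bary (T j) x 0 k == 0].
  by move/existsP: xk => [k /eqP xk]; rewrite (bigD1 k) //= xk mul0r mulr0.
have oj : osimplex (T j) x.
  move: xj; rewrite simplexE // => xj k; rewrite lt_def xj andbT.
  by move/existsPn: nz; exact.
have [c oc] := osimplex_nonempty (aff i).
have hj : \forall s \near (0 : R)^'+, osimplex (T j) (x - s *: (x - c)).
  apply: (@ray_cvg R d x (x - c) (osimplex (T j))); apply: open_nbhs_nbhs; split => //.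
  exact: open_osimplex.
have hi : \forall s \near (0 : R)^'+, osimplex (T i) (x - s *: (x - c)).
  near=> s => k.
  have s0 : 0 < s by near: s; exact: nbhs_right_gt.
  have s1 : s < 1 by near: s; exact: nbhs_right_lt.
  have -> : x - s *: (x - c) = x + s *: (c - x) by rewrite -scalerN opprB.
  have := baryE (T i) x (c - x) k; rewrite addrC subrK => ck.
  rewrite baryD mxE [X in _ + X]mxE.
  have xk : 0 <= bary (T i) x 0 k by move: xi; rewrite simplexE.
  have := oc k; rewrite ck; set a := bary _ _ _ _ in xk *; set b := bary_lin _ _ _ _ => ab.
  (* A convex combination of a coordinate of [x], which is nonnegative, and of [c], which is
     positive. *)
  have -> : a + s * b = (1 - s) * a + s * (a + b) by ring.
  by rewrite ltr_wpDl ?mulr_ge0 ?mulr_gt0 // subr_ge0 ltW.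
have [s [sj si]] := filter_ex (filterI hj hi).
have := disj _ _ ji; rewrite -subset0 => /(_ (x - s *: (x - c))) [].
by split; apply: osimplex_sub_interior.
Unshelve. all: by end_near. Qed.

(* The space dimension is d = n.+1 >= 2. *)
Theorem mainTheorem3 (R : realType) (n : nat) (Omega : set 'rV[R]_n.+1)
    (alpha f : 'rV[R]_n.+1 -> R) (alpha0 h kappa1 kappa2 : R) (k N : nat)
    (T : 'I_N -> 'M[R]_(n.+2, n.+1)) (u uh : 'rV[R]_n.+1 -> R) :
  (2 <= n.+1)%N ->
  polyhedral_domain Omega ->
  (exists M : R, forall x, Omega x -> `|alpha x| <= M) ->
  piecewise_continuous Omega alpha ->
  0 < alpha0 ->
  {ae leb n.+1, forall x, Omega x -> alpha0 <= alpha x} ->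
  L2 Omega f ->
  h < 1 ->
  triangulation Omega T ->
  (forall i, diam (simplex (T i)) <= h) ->
  shape_regular kappa1 T ->
  quasi_uniform kappa2 T ->
  (1 <= k)%N ->
  is_solution Omega alpha f u ->
  is_fe_solution Omega k T alpha f uh ->
  let ut := corrected alpha f uh T in
  forall i : 'I_N,
    bnd_flux_sub Omega alpha (T i) u ut =
      - (\int[leb n.+1]_(x in simplex (T i)) f x) - bnd_flux alpha (T i) ut /\
    - (\int[leb n.+1]_(x in simplex (T i)) f x) - bnd_flux alpha (T i) ut = 0.
Proof.
move=> n1 _ [M aM] apc a0 aa0 Lf _ htri _ _ _ _ [_ hdiv] [[_ hpoly _] _] ut i.
have [aff _ intO _ _] := htri.
have VO : osimplex (T i) `<=` Omega.
  by move=> x /(osimplex_sub_interior (aff i)); exact: intO.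
have flux_u := normal_flux_simplex (aff i) (intO i) Lf hdiv.
rewrite /bnd_flux_sub flux_u; split => //.
have [p [ppoly up]] := hpoly i.
have hp := C1_dir_poly ppoly.
pose c := bubble_coef alpha f uh (T i).
(* On one closed simplex, faces included, the corrections of all other simplices vanish, so the
   equations for the coefficients decouple. *)
have wp : {in simplex (T i), ut =1 fun x => p x + c * bubble_poly (T i) x}.
  move=> x xi; rewrite /ut /corrected (up x xi) (bigD1 i) //= big1 => [|j ji].
    by rewrite addr0 bubble_simplex.
  by rewrite (bubble_other_simplex htri ji) ?mulr0 //; rewrite inE in xi.
have [-> b0] := bnd_flux_corrected (aff i) n1 VO aM apc a0 aa0 hp up wp.
(* The bubble flux is negative, hence invertible, so the correction contributes exactly the missing
   flux. *)
rewrite /c /bubble_coef mulrAC mulVf ?lt_eqF // mul1r.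
by rewrite [_ + (_ - _)]addrC subrK subrr.
Qed.
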